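(* Let $n\ge1$, $0<\lambda<n$, $1\le p,q\le\infty$ and $s,t\in\mathbb{R}$. Then $\mathcal{I}_\lambda$ is bounded from $l(p,t)$ to $l(q,s)$ if and only if $(q,p,s,t)$ satisfies at least one of the conditions $\mathcal{C}_1,\mathcal{C}_3,\mathcal{C}_4$ below. $(\mathcal{C}_1)$: $s\le t$; $\frac\lambda n+\big(\frac1q+\frac sn\big)\vee0<\big(\frac1p+\frac tn\big)\vee0$; $\frac\lambda n+\frac1q+\frac sn\le1$; and $(q',-s)=(1,\lambda-n)$ if $\frac\lambda n+\frac1q+\frac sn=1$. $(\mathcal{C}_3)$: $s\le t$; $p=1$, $t=\lambda-n$, $\frac1q+\frac sn<0$. $(\mathcal{C}_4)$: $s\le t$; $\frac\lambda n+\frac1q+\frac sn=\frac1p+\frac tn$, $\frac1q\le\frac1p$; $\frac1q+\frac sn>0$, $\frac1p+\frac tn<1$; and if $s=t$ then $q\ne\infty$ and $p\ne1$.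
   Context: For $k\in\mathbb{Z}^n$, $\langle k\rangle=(1+|k|^2)^{1/2}$. For $1\le p\le\infty$, $s\in\mathbb{R}$, $l(p,s)$ is the space of $a:\mathbb{Z}^n\to\mathbb{C}$ with $\|a\|_{l(p,s)}=\big(\sum_{k}|a(k)|^p\langle k\rangle^{ps}\big)^{1/p}<\infty$ (supremum of $|a(k)|\langle k\rangle^s$ when $p=\infty$). The discrete fractional integral operator is $(\mathcal{I}_\lambda f)(k)=\sum_{j\in\mathbb{Z}^n,\,j\ne k}\frac{f(j)}{|k-j|^{n-\lambda}}$. ''Bounded from $l(p,t)$ to $l(q,s)$'' means $\|\mathcal{I}_\lambda f\|_{l(q,s)}\le C\|f\|_{l(p,t)}$ for all $f\in l(p,t)$. Conventions: $1/\infty=0$; $q'$ is the dual exponent, $1/q+1/q'=1$; $a\vee b=\max\{a,b\}$. *)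

(* Defs.v *)
From HB Require Import structures.
From mathcomp Require Import all_boot all_order all_algebra.
From mathcomp Require Import all_classical all_reals all_analysis.
From mathcomp Require Import complex.
Set Implicit Arguments. Unset Strict Implicit. Unset Printing Implicit Defensive.
Import Order.TTheory GRing.Theory Num.Theory.
Local Open Scope classical_set_scope.
Local Open Scope ring_scope.

Definition Zn (n : nat) := 'rV[int]_n.

Section Defs.
Variable R : realType.
Variable n : nat.

Definition sqnorm (k : Zn n) : R := \sum_(i < n) ((k ord0 i)%:~R) ^+ 2.
Definition jbr (k : Zn n) : R := Num.sqrt (1 + sqnorm k).
Definition cabs (z : R[i]) : R := Num.sqrt (complex.Re z ^+ 2 + complex.Im z ^+ 2).

Definition invE (p : \bar R) : R :=
  match p with r%:E => r^-1 | _ => 0 end.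
Definition dualE (q : \bar R) : \bar R :=
  match q with
  | r%:E => if r == 1 then +oo%E else (r / (r - 1))%:E
  | +oo%E => 1%E
  | -oo%E => -oo%E
  end.

Definition lnorm (p : \bar R) (s : R) (a : Zn n -> R[i]) : \bar R :=
  match p with
  | r%:E => ((\esum_(k in [set: Zn n]) ((cabs (a k) * jbr k `^ s) `^ r)%:E)
              `^ (r^-1))%E
  | _ => ereal_sup [set (cabs (a k) * jbr k `^ s)%:E | k in [set: Zn n]]
  end.

(* sum of an absolutely summable real / complex family *)
Definition rsum (D : set (Zn n)) (g : Zn n -> R) : R :=
  fine (\esum_(x in D) (Num.max (g x) 0)%:E) -
  fine (\esum_(x in D) (Num.max (- g x) 0)%:E).
Definition csum (D : set (Zn n)) (g : Zn n -> R[i]) : R[i] :=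
  Complex (rsum D (fun x => complex.Re (g x))) (rsum D (fun x => complex.Im (g x))).

Definition kern (lam : R) (k j : Zn n) : R :=
  Num.sqrt (sqnorm (k - j)) `^ (n%:R - lam).

Definition fracI (lam : R) (f : Zn n -> R[i]) (k : Zn n) : R[i] :=
  csum [set j | j != k]
    (fun j => Complex (complex.Re (f j) / kern lam k j) (complex.Im (f j) / kern lam k j)).

Definition fracI_defined (lam : R) (f : Zn n -> R[i]) (k : Zn n) : Prop :=
  summable [set j | j != k] (fun j => (cabs (f j) / kern lam k j)%:E).

Definition fracI_bounded (lam : R) (p : \bar R) (t : R) (q : \bar R) (s : R)
  : Prop :=
  exists C : R, forall f : Zn n -> R[i], (lnorm p t f < +oo)%E ->
    (forall k, fracI_defined lam f k) /\
    (lnorm q s (fracI lam f) <= C%:E * lnorm p t f)%E.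

Definition nR : R := n%:R.

Definition condC1 (lam : R) (q p : \bar R) (s t : R) : Prop :=
  [/\ s <= t,
      lam / nR + Num.max (invE q + s / nR) 0 < Num.max (invE p + t / nR) 0,
      lam / nR + invE q + s / nR <= 1 &
      (lam / nR + invE q + s / nR = 1 -> dualE q = 1%E /\ - s = lam - nR)].

Definition condC3 (lam : R) (q p : \bar R) (s t : R) : Prop :=
  [/\ s <= t, p = 1%E, t = lam - nR & invE q + s / nR < 0].

Definition condC4 (lam : R) (q p : \bar R) (s t : R) : Prop :=
  s <= t /\
  lam / nR + invE q + s / nR = invE p + t / nR /\
  invE q <= invE p /\
  invE q + s / nR > 0 /\
  invE p + t / nR < 1 /\
  (s = t -> q <> +oo%E /\ p <> 1%E).
End Defs.

(* Main.v *)
Require Import Defs.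
From HB Require Import structures.
From mathcomp Require Import all_boot all_order all_algebra.
From mathcomp Require Import all_classical all_reals all_analysis.
From mathcomp Require Import complex finmap ring lra zify.
Set Implicit Arguments. Unset Strict Implicit. Unset Printing Implicit Defensive.
Import Order.TTheory GRing.Theory Num.Theory.
Local Open Scope ring_scope.

(** By duality and normalisation, boundedness amounts to a uniform bound for the
    finite bilinear sums of [u_j^x v_k^y E_k^(-sg) E_j^(-tt) D_kj^(-(1-mu))] over
    families [u], [v] of total mass at most 1, where [x = 1/p], [y = 1/q'],
    [sg = -s/n], [tt = t/n], [mu = lam/n], [E_k = <k>^n] and [D_kj = |k-j|^n].
    In these variables the three conditions merge into one which is symmetric
    under [(x,tt) <-> (y,sg)], and only two facts on the lattice matter: the
    counting functions of [E] and [D] are linear, and [E], [D] satisfy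
    quasi-triangle inequalities.

    Sufficiency.  In the critical case [x + tt + y + sg = 1 + mu], on each of the
    regions [E_j << E_k], [E_k << E_j], [E_j ~ E_k] the kernel has the form
    [k1^(1-y) k2^(1-x)] with [sum_k k1 <= C] and [sum_j k2 <= C], and weighted
    AM-GM bounds each term by [u v + u k1 + v k2].  The exception is [E_j ~ E_k]
    with [sg + tt = 0], which is the Hardy-Littlewood-Sobolev inequality: when
    [v <= u], one bounds [v] by [u] if [D <= 1/u] and uses AM-GM if [D > 1/u], so
    that the sum over [k] is of order [u].  The subcritical case embeds into a
    critical one with exponents strictly inside [(0,1)], apart from two endpoint
    cases in which the kernel is at most [E_j^(-tt) + D^(-tt)].

    Necessity.  Test with pairs of neighbouring points, with annuli, and with [1/E]
    or [1/D] spread over many dyadic scales, where a logarithmic divergence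
    contradicts the remaining endpoint equalities. *)

(** * Powers, and sums controlled by a linear counting function *)

Section Powers.
Context {R : realType}.
Implicit Types a b x y r : R.

Lemma powR_expR a x : 0 < a -> a `^ x = expR (x * ln a).
Proof. by move=> a0; rewrite /powR gt_eqF. Qed.

Lemma powRD_ge0 a x y : 0 <= x -> 0 <= y -> a `^ (x + y) = a `^ x * a `^ y.
Proof.
move=> x0 y0; have [xy0|xy0] := eqVneq (x + y) 0; last by rewrite powRD ?(negbTE xy0).
have [-> ->] : x = 0 /\ y = 0 by split; lra.
by rewrite addr0 !powRr0 mulr1.
Qed.

Lemma powRV a x : 0 <= a -> a^-1 `^ x = (a `^ x)^-1.
Proof. by move=> a0; rewrite -powR_inv1// -powRrM mulN1r powRN. Qed.

Lemma ler_powRl r a b : 0 <= r -> 0 <= a -> a <= b -> a `^ r <= b `^ r.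
Proof.
by move=> r0 a0 ab; apply: ge0_ler_powR => //; rewrite nnegrE //; exact: le_trans ab.
Qed.

Lemma powR_ge1 a r : 1 <= a -> 0 <= r -> 1 <= a `^ r.
Proof. move=> a1 r0; have -> : 1 = 1 `^ r :> R by rewrite powR1.
exact: ler_powRl. Qed.

(** Each factor is at most the same power of [a + b + c], and the exponents add up to 1. *)
Lemma weighted_product_le_sum3 a b c x y z :
  0 <= a -> 0 <= b -> 0 <= c -> 0 <= x -> 0 <= y -> 0 <= z -> x + y + z = 1 ->
  a `^ x * b `^ y * c `^ z <= a + b + c.
Proof.
move=> a0 b0 c0 x0 y0 z0 s1.
rewrite -[leRHS]powRr1 -?s1; last by rewrite !addr_ge0.
rewrite !powRD_ge0 ?addr_ge0 //.
by rewrite !ler_pM ?mulr_ge0 ?powR_ge0 ?ler_powRl //; lra.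
Qed.

Lemma weighted_product_le_sum a b x :
  0 <= a -> 0 <= b -> 0 <= x <= 1 -> a `^ x * b `^ (1 - x) <= a + b.
Proof.
move=> a0 b0 /andP[x0 x1].
have := @weighted_product_le_sum3 a b 0 x (1 - x) 0 a0 b0 (lexx _) x0.
by rewrite powRr0 mulr1 !addr0; apply => //; lra.
Qed.

Lemma powR_unbounded r C : 0 < r -> exists2 b, 1 <= b & forall a, b <= a -> C < a `^ r.
Proof.
move=> r0; exists (Num.max 1 (Num.max 1 (C + 1) `^ r^-1)); first by rewrite le_max lexx.
move=> a; rewrite ge_max => /andP[a1 ha].
have m0 : 0 <= Num.max 1 (C + 1) by rewrite le_max ler01.
apply: (@lt_le_trans _ _ ((Num.max 1 (C + 1) `^ r^-1) `^ r)).
  rewrite -powRrM mulVf ?gt_eqF// powRr1//.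
  by rewrite lt_max; apply/orP; right; lra.
exact: ler_powRl (ltW r0) (powR_ge0 _ _) ha.
Qed.

(** Powers of comparable numbers are comparable, for either sign of [r]. The logarithmic form suits
    the later proofs, which compare products of powers through their logarithms. *)
Lemma near_powR c a b r : 0 < c -> 0 < a -> 0 < b -> a <= c * b -> b <= c * a ->
  r * (ln a - ln b) <= `|r| * ln c.
Proof.
move=> c0 a0 b0 ab ba.
have h1 : ln a <= ln c + ln b by rewrite -lnM ?posrE// ler_ln ?posrE ?mulr_gt0.
have h2 : ln b <= ln c + ln a by rewrite -lnM ?posrE// ler_ln ?posrE ?mulr_gt0.
apply: le_trans (ler_norm _) _; rewrite normrM ler_wpM2l// ler_norml; apply/andP; split; lra.
Qed.

(** Turns every logarithmic divergence into a contradiction: [M] counts scales, the left side is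
    what they contribute, the right side what boundedness permits. *)
Lemma powR_sublinear a C x : 0 < a -> x < 1 ->
  ~ (forall M : nat, (0 < M)%N -> a * M%:R <= C * M%:R `^ x).
Proof.
move=> a0 x1 h; have x1' : 0 < 1 - x by rewrite subr_gt0.
have [b b1 hb] := powR_unbounded (C / a) x1'.
have := archi_boundP (le_trans ler01 b1); set M := Num.Def.archi_bound b => hM.
have M0 : 0 < M%:R :> R by lra.
have := hb _ (ltW hM); rewrite ltr_pdivrMr// => h1.
have := h M; rewrite -(ltr0n R) => /(_ M0); apply/negP; rewrite -ltNge.
have -> : a * M%:R = (M%:R `^ (1 - x) * a) * M%:R `^ x.
  by rewrite mulrAC -powRD ?(gt_eqF M0) ?implybT// subrK powRr1 ?(ltW M0)// mulrC.
by rewrite ltr_pM2r// powR_gt0.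
Qed.

End Powers.

Section SummationByCounting.
Context {R : realType} {T : eqType}.
Variable c : R.
Hypothesis c_gt0 : 0 < c.

Definition linear_count (Phi : T -> R) := (forall k, 1 <= Phi k) /\
  forall s r, uniq s -> 0 < r -> (count (fun k => Phi k <= r) s)%:R <= c * r.

Implicit Types (Phi : T -> R) (r eta : R).

(** Makes the dyadic induction for tails terminate. *)
Lemma finite_pow2_bound Phi (s : seq T) r : 0 < r ->
  exists M, forall k, k \in s -> Phi k <= 2 ^+ M * r.
Proof.
move=> r0; elim: s => [|a s [M IH]]; first by exists 0%N.
have [N hN] : exists N, Phi a <= 2 ^+ N * r.
  have := archi_boundP (normr_ge0 (Phi a / r)).
  set N := Num.Def.archi_bound _ => hN; exists N.
  rewrite -ler_pdivrMr//; apply: (le_trans (le_trans (ler_norm _) (ltW hN))).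
  by rewrite -natrX ler_nat ltnW // ltn_expl.
have le2 m p : (m <= p)%N -> 2 ^+ m * r <= 2 ^+ p * r.
  by move=> mp; rewrite ler_pM2r// ler_weXn2l// ler1n.
exists (maxn M N) => k; rewrite inE => /orP[/eqP ->|ks].
  by rewrite (le_trans hN)// le2// leq_maxr.
by rewrite (le_trans (IH _ ks))// le2// leq_maxl.
Qed.

Lemma sum_le_count Phi (s : seq T) (P : pred T) (F : T -> R) r b :
  linear_count Phi -> uniq s -> 0 < r -> 0 <= b -> (forall k, P k -> Phi k <= r /\ F k <= b) ->
  \sum_(k <- s | P k) F k <= c * r * b.
Proof.
move=> [_ cnt] us r0 b0 PF.
apply: (@le_trans _ _ (\sum_(k <- s | P k) b)).
  by apply: ler_sum => k /PF[].
rewrite big_const_seq iter_addr_0 -mulr_natl ler_wpM2r//.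
apply: le_trans (cnt _ _ us r0); rewrite ler_nat.
by apply: sub_count => k /PF[].
Qed.

(** [K] is the fixed point of the recursion left by peeling off one dyadic shell: the shell costs
    [2 * c], and the remainder is the same sum shrunk by 2^(-eta). *)
Lemma geometric_constant eta : 0 < eta ->
  exists2 K, 0 <= K & K = 2 * c + K * 2 `^ (- eta).
Proof.
move=> eta0; have h2 : 2 `^ (- eta) < 1 :> R.
  rewrite powR_expR // -[ltRHS]expR0 ltr_expR mulNr oppr_lt0 mulr_gt0//.
  by apply: ln_gt0; lra.
exists (2 * c / (1 - 2 `^ (- eta))).
  by rewrite divr_ge0// ?mulr_ge0 ?ltW// subr_gt0.
by field; rewrite subr_eq0 gt_eqF.
Qed.

(** Induction on the number of dyadic shells above [r]: the shell [r < Phi k <= 2 * r] has at most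
    [c * (2 * r)] points, each contributing at most r^(-(1 + eta)). *)
Lemma tail_sum_le eta : 0 < eta -> exists2 K, 0 <= K & forall Phi s (r : R),
  linear_count Phi -> uniq s -> 0 < r ->
  \sum_(k <- s | r < Phi k) Phi k `^ (- (1 + eta)) <= K * r `^ (- eta).
Proof.
move=> eta0; have [K K0 KE] := geometric_constant eta0.
exists K => // Phi s r hPhi us r0; have [Phi_ge1 _] := hPhi.
have Phi_gt0 k : 0 < Phi k by exact: lt_le_trans (Phi_ge1 k).
have [M] := @finite_pow2_bound Phi s r r0.
elim: M r r0 => [|M IH] r r0 hM.
  rewrite big_seq_cond big1 ?mulr_ge0 ?powR_ge0// => k /andP[/hM].
  by rewrite expr0 mul1r => /le_lt_trans h /h; rewrite ltxx.
rewrite (bigID (fun k => Phi k <= 2 * r)) /=.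
apply: (@le_trans _ _ (c * (2 * r) * r `^ (- (1 + eta)) + K * (2 * r) `^ (- eta))).
  apply: lerD.
    apply: (sum_le_count hPhi); rewrite ?mulr_gt0 ?powR_ge0// => k /andP[h1 h2']; split => //.
    by rewrite !powRN lef_pV2 ?posrE ?powR_gt0// ler_powRl ?ltW//; lra.
  rewrite (eq_bigl (fun k => 2 * r < Phi k)); last first.
    move=> k; rewrite -ltNge andbC; apply/andb_idr => h; apply: lt_trans h; lra.
  by apply: IH; rewrite ?mulr_gt0// => k /hM; rewrite exprSr -mulrA.
rewrite (powRM _ (ler0n _ _) (ltW r0)) opprD powRD ?(gt_eqF r0) ?implybT//.
rewrite (powR_inv1 (ltW r0)).
rewrite {2}KE.
have -> : c * (2 * r) * (r^-1 * r `^ (- eta)) = 2 * c * r `^ (- eta).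
  by field; rewrite gt_eqF.
lra.
Qed.

(** The radius is halved until it drops below 1, where no point remains because [Phi] is at least
    1. *)
Lemma head_sum_le eta : 0 < eta -> exists2 K, 0 <= K & forall Phi s (r : R),
  linear_count Phi -> uniq s -> 0 < r ->
  \sum_(k <- s | Phi k <= r) Phi k `^ (- 1 + eta) <= K * r `^ eta.
Proof.
move=> eta0; have [K K0 KE] := geometric_constant eta0.
exists K => // Phi s r hPhi us r0; have [Phi_ge1 _] := hPhi.
have Phi_gt0 k : 0 < Phi k by exact: lt_le_trans (Phi_ge1 k).
have [M rM] : exists M, r < 2 ^+ M.
  exists (Num.Def.archi_bound r); apply: lt_le_trans (archi_boundP (ltW r0)) _.
  by rewrite -natrX ler_nat ltnW // ltn_expl.
elim: M r r0 rM => [|M IH] r r0 hM.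
  rewrite big1 ?mulr_ge0 ?powR_ge0// => k h.
  by have := Phi_ge1 k; move: hM; rewrite expr0; lra.
rewrite (bigID (fun k => Phi k <= r / 2)) /=.
apply: (@le_trans _ _ (K * (r / 2) `^ eta + c * r * ((r / 2)^-1 * r `^ eta))).
  apply: lerD.
    rewrite (eq_bigl (fun k => Phi k <= r / 2)); last first.
      by move=> k; rewrite andbC; apply/andb_idr => h; apply: le_trans h _; lra.
    by apply: IH; rewrite ?divr_gt0// ltr_pdivrMr// -exprSr.
  apply: (sum_le_count hPhi); rewrite ?mulr_ge0 ?powR_ge0 ?invr_ge0 ?divr_ge0 ?ltW// => k.
  rewrite -ltNge => /andP[h1 h2']; split => //.
  (* The sign of [- 1 + eta] is unknown, so the factor Phi^(-1) is bounded at the inner radius and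
     Phi^eta at the outer one. *)
  rewrite powRD ?(gt_eqF (Phi_gt0 k)) ?implybT// (powR_inv1 (ltW (Phi_gt0 k))).
  apply: ler_pM; rewrite ?powR_ge0// ?invr_ge0 ?(ltW (Phi_gt0 k))//.
    by rewrite ltW// ltf_pV2 ?posrE ?divr_gt0.
  by apply: ler_powRl => //; exact: ltW.
have h20 : 0 <= 2^-1 :> R by rewrite invr_ge0.
have e2 : 2^-1 `^ eta = 2 `^ (- eta) :> R by rewrite -powR_inv1// -powRrM mulN1r.
rewrite (powRM _ (ltW r0) h20) e2 {2}KE.
have -> : c * r * ((r / 2)^-1 * r `^ eta) = 2 * c * r `^ eta by field; rewrite gt_eqF.
lra.
Qed.

End SummationByCounting.

(** * Bilinear forms and the Hardy-Littlewood-Sobolev inequality *)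

(* [E k] models [<k>^n] and [D k j] models [|k - j|^n], raised to 1 on the diagonal. *)
Record regular_space (R : realType) (T : eqType) (E : T -> R) (D : T -> T -> R)
    (c : R) : Prop := RegularSpace {
  rs_c_ge1 : 1 <= c;
  rs_E_ge1 : forall k, 1 <= E k;
  rs_D_ge1 : forall k j, 1 <= D k j;
  rs_D_diag : forall j, D j j = 1;
  rs_D_sym : forall k j, D k j = D j k;
  rs_E_le : forall k j, E k <= c * Num.max (E j) (D k j);
  rs_D_le : forall k j, D k j <= c * Num.max (E k) (E j);
  rs_count_E : forall s r, uniq s -> 0 < r ->
    (count (fun k => E k <= r) s)%:R <= c * r;
  rs_count_D : forall j s r, uniq s -> 0 < r ->
    (count (fun k => D k j <= r) s)%:R <= c * r;
  rs_annulus : forall j r, 1 <= r -> exists s, [/\ uniq s, r <= c * (size s)%:R &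
    forall k, k \in s -> r < D k j <= c * r];
  rs_origin : exists o, E o = 1 }.

Section BilinearForms.
Context {R : realType} {T : eqType}.
Implicit Types (W : T -> T -> R) (x y : R).

(* Boundedness of the operator with kernel [W] from l^(1/x) to the dual of
   l^(1/y): the entries of the test functions are [u `^ x] and [v `^ y], so that
   [x = 0] (with [0 `^ 0 = 1]) covers the sup norm. *)
Definition kernel_bounded W x y := exists C : R, forall s1 s2 (u v : T -> R),
  uniq s1 -> uniq s2 -> (forall j, 0 <= u j) -> (forall k, 0 <= v k) ->
  \sum_(j <- s1) u j <= 1 -> \sum_(k <- s2) v k <= 1 ->
  \sum_(j <- s1) \sum_(k <- s2) u j `^ x * v k `^ y * W k j <= C.

Lemma kernel_bounded_le W W' M x y : 0 <= M -> (forall k j, W k j <= M * W' k j) ->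
  kernel_bounded W' x y -> kernel_bounded W x y.
Proof.
move=> M0 WW' [C hC]; exists (M * C) => s1 s2 u v us1 us2 u0 v0 su sv.
apply: le_trans (ler_wpM2l M0 (hC _ _ _ _ us1 us2 u0 v0 su sv)).
rewrite mulr_sumr ler_sum// => j _; rewrite mulr_sumr ler_sum// => k _.
by rewrite mulrCA ler_wpM2l// mulr_ge0 ?powR_ge0.
Qed.

Lemma kernel_boundedD W1 W2 x y : kernel_bounded W1 x y -> kernel_bounded W2 x y ->
  kernel_bounded (fun k j => W1 k j + W2 k j) x y.
Proof.
move=> [C1 h1] [C2 h2]; exists (C1 + C2) => s1 s2 u v us1 us2 u0 v0 su sv.
apply: le_trans (lerD (h1 _ _ _ _ us1 us2 u0 v0 su sv) (h2 _ _ _ _ us1 us2 u0 v0 su sv)).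
rewrite -big_split ler_sum// => j _; rewrite -big_split ler_sum// => k _.
by rewrite mulrDr.
Qed.

Lemma kernel_bounded_swap W x y :
  kernel_bounded W x y -> kernel_bounded (fun k j => W j k) y x.
Proof.
move=> [C h]; exists C => s1 s2 u v us1 us2 u0 v0 su sv.
rewrite exchange_big /=; apply: le_trans (h _ _ _ _ us2 us1 v0 u0 sv su).
by rewrite ler_sum// => j _; rewrite ler_sum// => k _; rewrite (mulrC (u _ `^ _)).
Qed.

(** Each term is at most (u v)^(x+y-1) (u k1)^(1-y) (v k2)^(1-x), whose exponents are nonnegative
    and add up to 1. Weighted AM-GM leaves three sums, bounded by 1, [C] and [C]. *)
Lemma kernel_bounded_young W k1 k2 C x y : 0 <= C -> 0 <= x <= 1 -> 0 <= y <= 1 -> 1 <= x + y ->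
  (forall k j, 0 <= k1 k j) -> (forall k j, 0 <= k2 k j) ->
  (forall j s, uniq s -> \sum_(k <- s) k1 k j <= C) ->
  (forall k s, uniq s -> \sum_(j <- s) k2 k j <= C) ->
  (forall k j, W k j <= k1 k j `^ (1 - y) * k2 k j `^ (1 - x)) ->
  kernel_bounded W x y.
Proof.
move=> C0 /andP[x0 x1] /andP[y0 y1] xy k10 k20 s1C s2C hW.
exists (1 + C + C) => s1 s2 u v us1 us2 u0 v0 su sv.
have u_sum : \sum_(j <- s1) u j * C <= C by rewrite -mulr_suml ler_piMl.
have v_sum : \sum_(k <- s2) v k * C <= C by rewrite -mulr_suml ler_piMl.
apply: (@le_trans _ _ (\sum_(j <- s1) \sum_(k <- s2) (u j * v k + u j * k1 k j + v k * k2 k j))).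
  apply: ler_sum => j _; apply: ler_sum => k _.
  have := @weighted_product_le_sum3 _ (u j * v k) (u j * k1 k j) (v k * k2 k j)
    (x + y - 1) (1 - y) (1 - x).
  rewrite !mulr_ge0// !subr_ge0 => /(_ isT isT isT xy y1 x1) h.
  apply: le_trans (h _); last by lra.
  rewrite !powRM ?mulr_ge0//.
  have -> : u j `^ x = u j `^ (x + y - 1) * u j `^ (1 - y).
    by rewrite -powRD_ge0 ?subr_ge0//; congr (_ `^ _); lra.
  have -> : v k `^ y = v k `^ (x + y - 1) * v k `^ (1 - x).
    by rewrite -powRD_ge0 ?subr_ge0//; congr (_ `^ _); lra.
  rewrite [leRHS](_ : _ = u j `^ (x + y - 1) * u j `^ (1 - y) *
    (v k `^ (x + y - 1) * v k `^ (1 - x)) * (k1 k j `^ (1 - y) * k2 k j `^ (1 - x))); last by ring.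
  by rewrite ler_wpM2l// !mulr_ge0 ?powR_ge0.
under eq_bigr do rewrite !big_split /=.
rewrite !big_split /= !lerD//.
- under eq_bigr do rewrite -mulr_sumr.
  rewrite -mulr_suml; apply: mulr_ile1 => //; exact: sumr_ge0.
- apply: le_trans u_sum; apply: ler_sum => j _.
  by rewrite -mulr_sumr ler_wpM2l ?s1C.
- rewrite exchange_big /=; apply: le_trans v_sum; apply: ler_sum => k _.
  by rewrite -mulr_sumr ler_wpM2l ?s2C.
Qed.

End BilinearForms.

Section HardyLittlewoodSobolev.
Context {R : realType} {T : eqType}.
Variables (E : T -> R) (D : T -> T -> R) (c : R).
Hypothesis S : regular_space E D c.
Variables (mu : R).
Hypothesis mu01 : 0 < mu < 1.

Implicit Types x y : R.

Let D0 k j : 0 < D k j. Proof. exact: lt_le_trans (rs_D_ge1 S k j). Qed.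
Let c0 : 0 < c. Proof. exact: lt_le_trans (rs_c_ge1 S). Qed.

(* A bound for [u `^ x * v `^ y * d `^ (- (1 - mu))] when [v <= u], whose sum over a
   family of [d] with linear counting function is of order [u]. *)
Definition hls_majorant x y (u d : R) : R :=
  if 0 < u then
    if d <= u^-1 then u `^ (1 + mu) * d `^ (- 1 + mu)
    else u `^ (1 - (1 - x) / (1 - y)) * d `^ (- (1 + (1 - x) / (1 - y)))
  else 0.

Lemma hls_majorant_ge0 x y u d : 0 <= hls_majorant x y u d.
Proof. by rewrite /hls_majorant; do 2?case: ifP => _ //; rewrite mulr_ge0 ?powR_ge0. Qed.

Lemma hls_pointwise x y u v d : 0 <= x < 1 -> 0 <= y < 1 -> x + y = 1 + mu ->
  0 <= v <= u -> 1 <= d ->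
  u `^ x * v `^ y * d `^ (- (1 - mu)) <= u * v + hls_majorant x y u d.
Proof.
move=> /andP[x0 x1] /andP[y0 y1] xy /andP[v0 vu] d1. case/andP: (mu01) => mu0 mu1.
have d0 : 0 < d by lra.
have [u0|u0] := ltP 0 u; last first.
  have -> : u = 0 by apply/le_anti; rewrite u0 (le_trans v0).
  by rewrite powR0 ?mul0r ?add0r ?hls_majorant_ge0//; apply/negP => /eqP; lra.
rewrite /hls_majorant u0; case: (leP d u^-1) => du.
  rewrite -[leLHS]add0r lerD ?mulr_ge0// ?(ltW u0)//.
  rewrite -xy powRD_ge0// [- (1 - mu)]opprB addrC ler_wpM2r ?powR_ge0//.
  by rewrite ler_wpM2l ?powR_ge0// ler_powRl.
(* AM-GM is applied to [v] and d^(-(1+b)) u^(-b) with weights [y] and [1 - y]. This [b] gives back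
   the power u^x after multiplication by [u], and then the power of [d] is right because x + y = 1 +
   mu. *)
set b := (1 - x) / (1 - y).
have hb : b * (1 - y) = 1 - x by rewrite divfK// subr_eq0 gt_eqF.
have := @weighted_product_le_sum _ v (d `^ (- (1 + b)) * u `^ (- b)) y v0.
rewrite mulr_ge0 ?powR_ge0// y0 ltW// => /(_ isT isT) h.
have e : u * (d `^ (- (1 + b)) * u `^ (- b)) `^ (1 - y) = u `^ x * d `^ (- (1 - mu)).
  rewrite powRM ?powR_ge0// -!powRrM !powR_expR// -{1}(lnK u0) -!expRD; congr expR.
  have := congr1 ( *%R ^~ (ln u)) hb; have := congr1 ( *%R ^~ (ln d)) hb; rewrite /=.
  have -> : x = 1 + mu - y by lra. lra.
have -> : u `^ x * v `^ y * d `^ (- (1 - mu)) =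
    u * (v `^ y * (d `^ (- (1 + b)) * u `^ (- b)) `^ (1 - y)).
  by rewrite mulrCA e; ring.
apply: le_trans (ler_wpM2l (ltW u0) h) _.
rewrite mulrDr lerD2l powRD ?(gt_eqF u0) ?implybT// powRr1 ?(ltW u0)//.
by rewrite mulrAC mulrA.
Qed.

(** Both branches are cut at radius 1/u: the head sum gives u^(1+mu) u^(-mu) and the tail sum
    u^(1-b) u^b, each equal to [u]. *)
Lemma hls_majorant_sum x y : 0 <= x < 1 -> 0 <= y < 1 -> exists2 K, 0 <= K &
  forall j s u, uniq s -> 0 <= u -> \sum_(k <- s) hls_majorant x y u (D k j) <= K * u.
Proof.
move=> /andP[x0 x1] /andP[y0 y1]; case/andP: (mu01) => mu0 mu1.
have b0 : 0 < (1 - x) / (1 - y) by rewrite divr_gt0; lra.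
set b := _ / _ in b0.
have [K1 K10 h1] := @head_sum_le _ T c c0 mu mu0.
have [K2 K20 h2] := @tail_sum_le _ T c c0 b b0.
exists (K1 + K2) => [|j s u us]; first exact: addr_ge0.
rewrite le_eqVlt => /predU1P[<-|u0].
  by rewrite mulr0 big1// => k _; rewrite /hls_majorant ltxx.
have hD : linear_count c (D ^~ j).
  by split => [k|]; [exact: (rs_D_ge1 S)|exact: (rs_count_D S)].
have iu0 : 0 < u^-1 by rewrite invr_gt0.
rewrite (bigID (fun k => D k j <= u^-1)) /= mulrDl; apply: lerD.
  rewrite (eq_bigr (fun k => u `^ (1 + mu) * D k j `^ (- 1 + mu))); last first.
    by move=> k h; rewrite /hls_majorant u0 h.
  rewrite -mulr_sumr; apply: le_trans (ler_wpM2l (powR_ge0 _ _) (h1 _ _ _ hD us iu0)) _.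
  rewrite -(powR_inv1 (ltW u0)) -powRrM mulrCA -powRD ?(gt_eqF u0) ?implybT//.
  have -> : 1 + mu + -1 * mu = 1 by lra.
  by rewrite powRr1// ltW.
rewrite (eq_bigl (fun k => u^-1 < D k j)); last by move=> k; rewrite -ltNge.
rewrite (eq_bigr (fun k => u `^ (1 - b) * D k j `^ (- (1 + b)))); last first.
  by move=> k h; rewrite /hls_majorant u0 leNgt h.
rewrite -mulr_sumr; apply: le_trans (ler_wpM2l (powR_ge0 _ _) (h2 _ _ _ hD us iu0)) _.
rewrite -(powR_inv1 (ltW u0)) -powRrM mulrCA -powRD ?(gt_eqF u0) ?implybT//.
have -> : 1 - b + -1 * - b = 1 by lra.
  by rewrite powRr1// ltW.
Qed.

(** Each pair is charged to the larger of [u j] and [v k]; adding both majorants covers the two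
    cases without splitting the sum. *)
Lemma hls_kernel_bounded x y : 0 <= x < 1 -> 0 <= y < 1 -> x + y = 1 + mu ->
  kernel_bounded (fun k j => D k j `^ (- (1 - mu))) x y.
Proof.
move=> x01 y01 xy; case/andP: (mu01) => mu0 mu1.
have [K1 K10 h1] := hls_majorant_sum x01 y01.
have [K2 K20 h2] := hls_majorant_sum y01 x01.
exists (1 + K1 + K2) => s1 s2 u v us1 us2 u0 v0 su sv.
apply: (@le_trans _ _ (\sum_(j <- s1) \sum_(k <- s2) (u j * v k +
    hls_majorant x y (u j) (D k j) + hls_majorant y x (v k) (D j k)))).
  apply: ler_sum => j _; apply: ler_sum => k _.
  have [vu|/ltW uv] := leP (v k) (u j).
    rewrite -[leLHS]addr0 lerD ?hls_majorant_ge0// hls_pointwise// ?v0//.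
    exact: (rs_D_ge1 S).
  rewrite addrAC -[leLHS]addr0 lerD ?hls_majorant_ge0//.
  rewrite (mulrC (u j)) (mulrC (u j `^ x)) (rs_D_sym S).
  by apply: hls_pointwise; rewrite ?u0// 1?addrC//; exact: (rs_D_ge1 S).
under eq_bigr do rewrite !big_split /=.
rewrite !big_split /= !lerD//.
- under eq_bigr do rewrite -mulr_sumr.
  rewrite -mulr_suml; apply: mulr_ile1 => //; exact: sumr_ge0.
- apply: (@le_trans _ _ (\sum_(j <- s1) K1 * u j)); last by rewrite -mulr_sumr ler_piMr.
  by apply: ler_sum => j _; exact: h1.
- rewrite exchange_big /=.
  apply: (@le_trans _ _ (\sum_(j <- s2) K2 * v j)); last by rewrite -mulr_sumr ler_piMr.
  by apply: ler_sum => j _; exact: h2.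
Qed.

End HardyLittlewoodSobolev.

(** * The critical case *)

Section SteinWeiss.
Context {R : realType} {T : eqType}.
Variables (E : T -> R) (D : T -> T -> R) (c : R).
Hypothesis S : regular_space E D c.
Variables (mu : R).
Hypothesis mu01 : 0 < mu < 1.
Implicit Types x y sg tt : R.

Let D0 k j : 0 < D k j. Proof. exact: lt_le_trans (rs_D_ge1 S k j). Qed.
Let E0 k : 0 < E k. Proof. exact: lt_le_trans (rs_E_ge1 S k). Qed.
Let c1 : 1 <= c. Proof. exact: rs_c_ge1 S. Qed.
Let c0 : 0 < c. Proof. exact: lt_le_trans (rs_c_ge1 S). Qed.
Let lnc0 : 0 <= ln c. Proof. by rewrite ln_ge0. Qed.

Let countE : linear_count c E.
Proof. by split; [exact: (rs_E_ge1 S)|exact: (rs_count_E S)]. Qed.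

Let countD j : linear_count c (D ^~ j).
Proof. by split => [k|]; [exact: (rs_D_ge1 S)|exact: (rs_count_D S)]. Qed.

Definition weighted_kernel sg tt (k j : T) : R :=
  E k `^ (- sg) * E j `^ (- tt) * D k j `^ (- (1 - mu)).

Lemma weighted_kernel_ge0 sg tt k j : 0 <= weighted_kernel sg tt k j.
Proof. by rewrite !mulr_ge0 ?powR_ge0. Qed.

Lemma weighted_kernel_sym sg tt k j : weighted_kernel sg tt k j = weighted_kernel tt sg j k.
Proof. by rewrite /weighted_kernel (rs_D_sym S) [E k `^ _ * _]mulrC. Qed.

(** Here [D k j] dominates [E k], so the kernel is bounded in terms of [E] alone. It factors into
    [k1], a tail sum in [k], and [k2], a head sum in [j]. *)
Lemma kernel_bounded_far x y sg tt : 0 <= x <= 1 -> 0 <= y <= 1 -> 1 <= x + y < 2 ->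
  x + tt < 1 -> (x + tt) + (y + sg) = 1 + mu ->
  kernel_bounded (fun k j => if c * E j < E k then weighted_kernel sg tt k j else 0) x y.
Proof.
move=> x01 y01 /andP[xy1 xy2] xt AB; case/andP: (mu01) => mu0 mu1.
(* Found by matching the exponent of [E j] in k1^(1-y) k2^(1-x) with [- tt]; it is positive exactly
   because x + tt < 1. *)
pose eta := (1 - (x + tt)) / (2 - x - y).
have heta : eta * (2 - x - y) = 1 - (x + tt) by rewrite divfK//; apply/negP => /eqP; lra.
have eta0 : 0 < eta by rewrite divr_gt0; lra.
have [K1 K10 h1] := @tail_sum_le _ T c c0 eta eta0.
have [K2 K20 h2] := @head_sum_le _ T c c0 eta eta0.
pose k1 k j := if c * E j < E k then E k `^ (- (1 + eta)) * E j `^ eta else 0.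
pose k2 k j := if c * E j < E k then E j `^ (- 1 + eta) * E k `^ (- eta) else 0.
apply: (@kernel_bounded_le _ _ _ (fun k j => k1 k j `^ (1 - y) * k2 k j `^ (1 - x))
  (expR ((1 - mu) * ln c))); first exact: expR_ge0.
  move=> k j; rewrite /k1 /k2; case: ifPn => [h|_]; last first.
    by rewrite mulr_ge0 ?expR_ge0 ?mulr_ge0 ?powR_ge0.
  (* The maximum in the quasi-triangle inequality cannot be [E j], since [c * E j < E k]. *)
  have hD : ln (E k) <= ln c + ln (D k j).
    rewrite -lnM ?posrE// ler_ln ?posrE ?mulr_gt0//.
    have := rs_E_le S k j; rewrite maxr_pMr ?(ltW c0)// le_max => /orP[|//].
    by move=> /(lt_le_trans h); rewrite ltxx.
  rewrite /weighted_kernel !powRM ?powR_ge0// -!powRrM !powR_expR// -!expRD ler_expR.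
  have -> : sg = 1 + mu - x - tt - y by lra.
  have -> : tt = 1 - x - eta * (2 - x - y) by lra.
  have : (1 - mu) * ln (E k) <= (1 - mu) * (ln c + ln (D k j)) by rewrite ler_wpM2l//; lra.
  move=> {AB heta} h'; lra.
apply: (@kernel_bounded_young _ _ _ k1 k2 (K1 + K2)) => //.
- exact: addr_ge0.
- by move=> k j; rewrite /k1; case: ifP => _//; rewrite mulr_ge0 ?powR_ge0.
- by move=> k j; rewrite /k2; case: ifP => _//; rewrite mulr_ge0 ?powR_ge0.
- move=> j s us; rewrite -big_mkcond -mulr_suml.
  apply: (le_trans (ler_wpM2r (powR_ge0 _ _) (h1 _ _ _ countE us _))); first exact: mulr_gt0.
  apply: (@le_trans _ _ K1); last by rewrite lerDl.
  rewrite -mulrA ler_piMr// !powR_expR ?mulr_gt0// lnM ?posrE// -expRD.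
  rewrite -[leRHS]expR0 ler_expR; have := mulr_ge0 (ltW eta0) lnc0; lra.
- move=> k s us; rewrite (eq_bigr (fun j => if E j < E k / c then
    E j `^ (- 1 + eta) * E k `^ (- eta) else 0)); last first.
    by move=> j _; rewrite /k2 ltr_pdivlMr// mulrC.
  have Ekc : 0 < E k / c by rewrite divr_gt0.
  rewrite -big_mkcond -mulr_suml.
  apply: (@le_trans _ _ (\sum_(j <- s | E j <= E k / c) E j `^ (- 1 + eta) * E k `^ (- eta))).
    rewrite mulr_suml [leLHS]big_mkcond [leRHS]big_mkcond; apply: ler_sum => j _.
    by case: ltP => [/ltW ->//|_]; case: ifP => // _; rewrite mulr_ge0 ?powR_ge0.
  rewrite -mulr_suml.
  apply: (le_trans (ler_wpM2r (powR_ge0 _ _) (h2 _ _ _ countE us Ekc))).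
  apply: (@le_trans _ _ K2); last by rewrite lerDr.
  rewrite -mulrA ler_piMr// !powR_expR// lnM ?posrE ?invr_gt0// lnV ?posrE// -expRD.
  rewrite -[leRHS]expR0 ler_expR; have := mulr_ge0 (ltW eta0) lnc0; lra.
Qed.

(** When [E k] and [E j] are comparable, [D k j] is at most a multiple of either, so head sums of
    [D] up to that radius bound both factors. *)
Lemma kernel_bounded_near_gt0 x y sg tt : 0 <= x <= 1 -> 0 <= y <= 1 -> 1 <= x + y ->
  0 < sg + tt -> (x + tt) + (y + sg) = 1 + mu ->
  kernel_bounded (fun k j => if (E k <= c * E j) && (E j <= c * E k)
    then weighted_kernel sg tt k j else 0) x y.
Proof.
move=> x01 y01 xy1 st AB; case/andP: (mu01) => mu0 mu1.
have xy2 : 0 < 2 - x - y by lra.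
(* Found by matching the exponent of [D], which must be [- (1 - mu)]; positivity of [sg + tt] is
   what makes the head sums converge. *)
pose eta := (sg + tt) / (2 - x - y).
have heta : eta * (2 - x - y) = sg + tt by rewrite divfK// gt_eqF.
have eta0 : 0 < eta by rewrite divr_gt0; lra.
have [K K0 hK] := @head_sum_le _ T c c0 eta eta0.
pose close k j := (E k <= c * E j) && (E j <= c * E k).
pose k1 k j := if close k j then D k j `^ (- 1 + eta) * E j `^ (- eta) else 0.
pose k2 k j := if close k j then D k j `^ (- 1 + eta) * E k `^ (- eta) else 0.
apply: (@kernel_bounded_le _ _ _ (fun k j => k1 k j `^ (1 - y) * k2 k j `^ (1 - x))
  (expR (`|eta * (1 - x) - sg| * ln c))); first exact: expR_ge0.
  move=> k j; rewrite /k1 /k2 /close; case: ifPn => [/andP[h h']|_]; last first.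
    by rewrite mulr_ge0 ?expR_ge0 ?mulr_ge0 ?powR_ge0.
  have hE := near_powR (eta * (1 - x) - sg) c0 (E0 k) (E0 j) h h'.
  rewrite /weighted_kernel !powRM ?powR_ge0// -!powRrM !powR_expR// -!expRD ler_expR.
  apply: le_trans (lerD hE (lexx _)).
  have -> : mu = (x + y + eta * (2 - x - y)) - 1 by lra.
  have -> : tt = eta * (2 - x - y) - sg by lra.
  lra.
have key k j : close k j -> D k j <= c * c * E j.
  move=> /andP[h1 h2]; apply: le_trans (rs_D_le S k j) _.
  rewrite -mulrA ler_wpM2l ?(ltW c0)// ge_max h1 ler_peMl // ltW//.
have key2 : forall j s, uniq s ->
    \sum_(k <- s) (if close k j then D k j `^ (- 1 + eta) * E j `^ (- eta) else 0) <=
    K * expR (eta * ln (c * c)).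
  move=> j s us.
  have ccE : 0 < c * c * E j by rewrite !mulr_gt0.
  apply: (@le_trans _ _ (\sum_(k <- s | D k j <= c * c * E j)
    D k j `^ (- 1 + eta) * E j `^ (- eta))).
    rewrite [leRHS]big_mkcond; apply: ler_sum => k _.
    by case: ifPn => [/key ->//|_]; case: ifP => // _; rewrite mulr_ge0 ?powR_ge0.
  rewrite -mulr_suml.
  apply: (le_trans (ler_wpM2r (powR_ge0 _ _) (hK _ _ _ (countD j) us ccE))).
  rewrite -[leLHS]mulrA ler_wpM2l// !powR_expR//
    (@lnM _ (c * c)) ?posrE ?mulr_gt0// -expRD ler_expR.
  lra.
apply: (@kernel_bounded_young _ _ _ k1 k2 (K * expR (eta * ln (c * c)))) => //.
- by rewrite mulr_ge0 ?expR_ge0.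
- by move=> k j; rewrite /k1; case: ifP => _//; rewrite mulr_ge0 ?powR_ge0.
- by move=> k j; rewrite /k2; case: ifP => _//; rewrite mulr_ge0 ?powR_ge0.
- move=> k s us; apply: le_trans (key2 k s us); apply: ler_sum => j _.
  by rewrite /k2 /close andbC (rs_D_sym S).
Qed.

(** The weights cancel up to a constant and x + y = 1 + mu, which leaves the unweighted
    Hardy-Littlewood-Sobolev kernel. *)
Lemma kernel_bounded_near_eq0 x y sg tt : 0 <= x < 1 -> 0 <= y < 1 ->
  sg + tt = 0 -> (x + tt) + (y + sg) = 1 + mu ->
  kernel_bounded (fun k j => if (E k <= c * E j) && (E j <= c * E k)
    then weighted_kernel sg tt k j else 0) x y.
Proof.
move=> x01 y01 st AB.
apply: kernel_bounded_le (expR_ge0 (`|- sg| * ln c)) _ (hls_kernel_bounded S mu01 x01 y01 _).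
  move=> k j; case: ifPn => [/andP[h h']|_]; last by rewrite mulr_ge0 ?expR_ge0 ?powR_ge0.
  rewrite /weighted_kernel ler_wpM2r ?powR_ge0// !powR_expR// -expRD ler_expR.
  apply: le_trans (near_powR (- sg) c0 (E0 k) (E0 j) h h').
  have -> : tt = - sg by lra.
  lra.
lra.
Qed.

Lemma kernel_bounded_critical x y sg tt : 0 <= x <= 1 -> 0 <= y <= 1 -> 1 <= x + y ->
  0 <= sg + tt -> (x + tt) + (y + sg) = 1 + mu -> x + tt < 1 -> y + sg < 1 ->
  (sg + tt = 0 -> x < 1 /\ y < 1) ->
  kernel_bounded (weighted_kernel sg tt) x y.
Proof.
move=> x01 y01 xy1 st AB B1 A1 hst; case/andP: (mu01) => mu0 mu1.
have xy2 : 1 <= x + y < 2 by rewrite xy1 /=; lra.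
have far1 := kernel_bounded_far x01 y01 xy2 B1 AB.
(* The mirror region, by exchanging the roles of the two variables. *)
have far2 : kernel_bounded (fun k j => if c * E k < E j then weighted_kernel sg tt k j else 0) x y.
  apply: kernel_bounded_le ler01 _ (kernel_bounded_swap
    (@kernel_bounded_far y x tt sg y01 x01 _ A1 _)).
  - by move=> k j; rewrite mul1r weighted_kernel_sym.
  - by rewrite addrC.
  - lra.
have hnear : kernel_bounded (fun k j => if (E k <= c * E j) && (E j <= c * E k)
    then weighted_kernel sg tt k j else 0) x y.
  move: st; rewrite le_eqVlt => /predU1P[/esym st|st].
    have [x1 y1] := hst st.
    by apply: kernel_bounded_near_eq0 => //; apply/andP; split => //; lra.
  exact: kernel_bounded_near_gt0.
apply: kernel_bounded_le ler01 _ (kernel_boundedD (kernel_boundedD far1 far2) hnear).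
move=> k j; rewrite mul1r.
have W0 := weighted_kernel_ge0 sg tt k j.
have [h1|h1] := leP (E k) (c * E j); have [h2|h2] := leP (E j) (c * E k) => /=; lra.
Qed.

End SteinWeiss.

(** * Subcritical exponents and endpoints *)

(** Chooses the critical problem with exponents [p], [q] and weights [A - q], [B - p]. The last line
    says that each original space embeds into the new one, strictly in the homogeneity index. *)
Lemma critical_exponents (R : realType) (mu x y sg tt : R) : 0 < mu < 1 ->
  0 <= x <= 1 -> 0 <= y <= 1 -> 0 <= sg + tt -> 1 + mu < (x + tt) + (y + sg) ->
  mu < x + tt -> mu < y + sg -> exists p q A B : R,
  [/\ [/\ 0 < p < 1, 0 < q < 1 & 1 <= p + q <= 1 + mu],
      [/\ B + A = 1 + mu, A < 1 & B < 1],
      B < x + tt /\ B - p <= tt & A < y + sg /\ A - q <= sg].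
Proof.
move=> /andP[mu0 mu1] /andP[x0 x1] /andP[y0 y1] st AB hB hA.
have [B [B1 B2 B3 B4]] : exists B, [/\ mu < B, 1 + mu - (y + sg) < B, B < 1 & B < x + tt].
  exists ((Num.max mu (1 + mu - (y + sg)) + Num.min 1 (x + tt)) / 2).
  move: (y + sg) (x + tt) AB hB hA => a b; move=> {x0 x1 y0 y1 st}.
  by case: (leP mu); case: (leP 1 b) => h1 h2 *; split; lra.
have [A AE] : exists A, A = 1 + mu - B by exists (1 + mu - B).
have X0 : 0 < 1 - A + sg by lra.
have Y1 : B - tt < 1 by lra.
have YX : B - tt <= 1 - A + sg + mu by lra.
have A1 : A < 1 by lra.
have A2 : A < y + sg by lra.
move: (erefl (1 - A + sg)) (erefl (B - tt)) X0 Y1 YX.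
move: {1 3 4}(1 - A + sg) {1 3 4}(B - tt) => X Y XE YE X0 Y1 YX.
(* This [q] is one minus the second exponent. The weights demand [q <= X] and [Y <= p], and 1 <= p +
   (1 - q) <= 1 + mu means q <= p <= q + mu. Solvability rests on [YX], a restatement of 0 <= sg +
   tt. *)
have [q [q0 qX q1 Yq]] : exists q, [/\ 0 < q, q <= X, q < 1 & Y <= q + mu].
  move: X0 Y1 YX mu0; clear => X0 Y1 YX mu0.
  by have [h1|h1] := leP Y 2^-1; [have [h2|h2] := leP X 2^-1; [exists X|exists 2^-1]|
    have [h2|h2] := leP X Y; [exists X|exists Y]]; split; lra.
have [p [qp p1 Yp pq]] : exists p, [/\ q <= p, p < 1, Y <= p & p <= q + mu].
  move: mu0 q0 q1 Y1 Yq; clear => mu0 q0 q1 Y1 Yq.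
  by have [h|h] := leP Y q; [exists q|exists Y]; split; lra.
exists p, (1 - q), A, B; split.
- by split; apply/andP; split; lra.
- by split => //; lra.
- by split => //; lra.
- by split => //; lra.
Qed.

Section Sufficiency.
Context {R : realType} {T : eqType}.
Variables (E : T -> R) (D : T -> T -> R) (c : R).
Hypothesis S : regular_space E D c.
Variables (mu : R).
Hypothesis mu01 : 0 < mu < 1.
Implicit Types x y sg tt : R.

Let D0 k j : 0 < D k j. Proof. exact: lt_le_trans (rs_D_ge1 S k j). Qed.
Let E0 k : 0 < E k. Proof. exact: lt_le_trans (rs_E_ge1 S k). Qed.
Let c1 : 1 <= c. Proof. exact: rs_c_ge1 S. Qed.
Let c0 : 0 < c. Proof. exact: lt_le_trans (rs_c_ge1 S). Qed.

Let countE : linear_count c E.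
Proof. by split; [exact: (rs_E_ge1 S)|exact: (rs_count_E S)]. Qed.

Let countD j : linear_count c (D j).
Proof.
split => [k|s r us r0]; first exact: (rs_D_ge1 S).
under eq_count do rewrite (rs_D_sym S j); exact: (rs_count_D S).
Qed.

Lemma sum_powR_le eta : 0 < eta -> exists2 K, 0 <= K & forall Phi (s : seq T),
  linear_count c Phi -> uniq s -> \sum_(k <- s) Phi k `^ (- (1 + eta)) <= K.
Proof.
move=> eta0; have [K K0 hK] := @tail_sum_le _ T c c0 eta eta0.
(* The radius 1/2 lies below every value of [Phi], so the tail is the whole sum. *)
exists (K * 2^-1 `^ (- eta)) => [|Phi s hPhi us]; first by rewrite mulr_ge0 ?powR_ge0.
have h : 0 < 2^-1 :> R by rewrite invr_gt0.
apply: le_trans (hK _ _ _ hPhi us h); rewrite (eq_bigl (fun k => 2^-1 < Phi k))// => k.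
have [P1 _] := hPhi; rewrite (lt_le_trans _ (P1 k))// invf_lt1//; lra.
Qed.

(** Pointwise form of the embedding of weighted spaces. For [x' <= x] it is monotonicity in the
    exponent, as [u <= 1]; otherwise it is Hölder's inequality against a summable power of [e]. *)
Lemma embedding_exponent x tt x' tt' : 0 <= x -> 0 < x' -> tt' <= tt -> x' + tt' < x + tt ->
  exists2 eta, 0 < eta & forall u e : R, 0 <= u <= 1 -> 1 <= e ->
    u `^ x * e `^ (- tt) <= (u + e `^ (- (1 + eta))) `^ x' * e `^ (- tt').
Proof.
move=> x0 x'0 tle xt; have [xx'|xx'] := leP x' x.
  exists 1 => // u e /andP[u0 u1] e1; apply: ler_pM; rewrite ?powR_ge0//.
    apply: (@le_trans _ _ (u `^ x')); last by rewrite ler_powRl ?lerDl ?powR_ge0// ltW.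
    move: u0; rewrite le_eqVlt => /predU1P[<-|u0]; last by rewrite ger_powR// u0.
    have xn0 : x != 0 by rewrite gt_eqF//; lra.
    by rewrite powR0// powR_ge0.
  by rewrite ler_powR// lerN2.
(* The surplus weight [tt - tt'] pays for the auxiliary family e^(-a); the strict inequality between
   the indices is exactly 1 < a, its summability. *)
have [a a1 ha] : exists2 a, 1 < a & a * (x' - x) = tt - tt'.
  exists ((tt - tt') / (x' - x)); last by rewrite divfK// gt_eqF// subr_gt0.
  by rewrite ltr_pdivlMr ?subr_gt0//; lra.
exists (a - 1) => [|u e /andP[u0 u1] e1]; first by rewrite subr_gt0.
have -> : 1 + (a - 1) = a by lra.
have e0 : 0 < e by lra.
have th : 0 <= x / x' <= 1 by rewrite divr_ge0 ?ler_pdivrMr// ?mul1r ltW.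
have := weighted_product_le_sum u0 (powR_ge0 e (- a)) th.
move=> /(ler_powRl (ltW x'0)) h.
have h' := h (mulr_ge0 (powR_ge0 _ _) (powR_ge0 _ _)).
apply: le_trans (ler_wpM2r (powR_ge0 e (- tt')) h').
rewrite powRM ?powR_ge0// -!powRrM divfK ?gt_eqF// -mulrA ler_wpM2l ?powR_ge0//.
rewrite !powR_expR// -expRD ler_expR.
have -> : - a * ((1 - x / x') * x') = - (a * (x' - x)).
  by field; rewrite gt_eqF.
rewrite ha le_eqVlt; apply/orP; left; apply/eqP; ring.
Qed.

Lemma mem_sum_le (s : seq T) (u : T -> R) j : (forall i, 0 <= u i) -> j \in s ->
  u j <= \sum_(i <- s) u i.
Proof. by move=> u0 js; rewrite (big_rem j)//= lerDl sumr_ge0. Qed.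

Lemma kernel_bounded_embed x y sg tt x' tt' :
  0 <= x -> 0 < x' -> tt' <= tt -> x' + tt' < x + tt ->
  kernel_bounded (weighted_kernel E D mu sg tt') x' y ->
  kernel_bounded (weighted_kernel E D mu sg tt) x y.
Proof.
move=> x0 x'0 tt'tt xt [C hC].
have [eta eta0 heta] := embedding_exponent x0 x'0 tt'tt xt.
have [K K0 hK] := sum_powR_le eta0.
have K1 : 0 < 1 + K by lra.
exists ((1 + K) `^ x' * C) => s1 s2 u v us1 us2 u0 v0 su sv.
(* The enlarged family is renormalised to mass at most 1, at the price of the factor (1 + K)^x'. *)
pose u' j := (u j + E j `^ (- (1 + eta))) / (1 + K).
have u'0 j : 0 <= u' j by rewrite divr_ge0 ?addr_ge0 ?powR_ge0// ltW.
have su' : \sum_(j <- s1) u' j <= 1.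
  by rewrite -mulr_suml ler_pdivrMr// mul1r big_split /= lerD// hK.
apply: le_trans (ler_wpM2l (powR_ge0 _ _) (hC _ _ _ _ us1 us2 u'0 v0 su' sv)).
rewrite mulr_sumr big_seq [leRHS]big_seq; apply: ler_sum => j js.
rewrite mulr_sumr; apply: ler_sum => k _.
have u1 : 0 <= u j <= 1 by rewrite u0 (le_trans _ su)// mem_sum_le.
have := heta _ _ u1 (rs_E_ge1 S j).
have -> : u j + E j `^ (- (1 + eta)) = (1 + K) * u' j by rewrite mulrC divfK// gt_eqF.
rewrite powRM ?(ltW K1)// => h.
rewrite /weighted_kernel [leLHS](_ : _ = (u j `^ x * E j `^ (- tt)) *
  (v k `^ y * E k `^ (- sg) * D k j `^ (- (1 - mu)))); last by ring.
rewrite [leRHS](_ : _ = ((1 + K) `^ x' * u' j `^ x' * E j `^ (- tt')) *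
  (v k `^ y * E k `^ (- sg) * D k j `^ (- (1 - mu)))); last by ring.
by rewrite ler_wpM2r// !mulr_ge0 ?powR_ge0.
Qed.

Lemma kernel_bounded_weighted_sym x y sg tt : kernel_bounded (weighted_kernel E D mu sg tt) x y ->
  kernel_bounded (weighted_kernel E D mu tt sg) y x.
Proof.
move=> /kernel_bounded_swap; apply: kernel_bounded_le ler01 _ => k j.
by rewrite mul1r (weighted_kernel_sym S).
Qed.

(** A critical estimate with exponents strictly inside (0,1) is pulled back by embedding one
    variable, exchanging the variables, and embedding the other. *)
Lemma kernel_bounded_subcritical x y sg tt : 0 <= x <= 1 -> 0 <= y <= 1 ->
  0 <= sg + tt -> 1 + mu < (x + tt) + (y + sg) -> mu < x + tt -> mu < y + sg ->
  kernel_bounded (weighted_kernel E D mu sg tt) x y.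
Proof.
move=> x01 y01 st AB hB hA.
have [p [q [A' [B' [[/andP[p0 p1] /andP[q0 q1] pq] [AB' A1 B1] [hx ht] [hy hs]]]]]] :=
  critical_exponents mu01 x01 y01 st AB hB hA.
have crit : kernel_bounded (weighted_kernel E D mu (A' - q) (B' - p)) p q.
  apply: (kernel_bounded_critical S mu01); rewrite ?subrKC ?(ltW p0) ?(ltW q0) ?(ltW p1) ?(ltW q1)//.
    by case/andP: pq.
  by rewrite addrACA -opprD subr_ge0 (addrC q) (addrC A') AB'; case/andP: pq.
case/andP: x01 => x0 _; case/andP: y01 => y0 _.
apply: (@kernel_bounded_embed x y sg tt p (B' - p)); rewrite ?subrKC//.
apply: kernel_bounded_weighted_sym.
apply: (@kernel_bounded_embed y p (B' - p) sg q (A' - q)); rewrite ?subrKC//.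
exact: kernel_bounded_weighted_sym.
Qed.

(** With y = 1 it suffices to bound the sum over [j] uniformly in [k]. For x < 1 Hölder's inequality
    applies, since Phi^(-tt/(1-x)) is summable; for x = 1 the kernel is at most 1. *)
Lemma kernel_bounded_sup (Phi : T -> T -> R) x tt : 0 <= x <= 1 -> 0 <= tt -> 1 < x + tt ->
  (forall k, linear_count c (Phi k)) ->
  kernel_bounded (fun k j => Phi k j `^ (- tt)) x 1.
Proof.
move=> /andP[x0 x1] tt0 xt hPhi.
have [K K0 hK] : exists2 K, 0 <= K & forall k s u, uniq s -> (forall j, 0 <= u j) ->
    \sum_(j <- s) u j <= 1 -> \sum_(j <- s) u j `^ x * Phi k j `^ (- tt) <= K.
  move: x1; rewrite le_eqVlt => /predU1P[->|x1].
    exists 1 => // k s u us u0 su; apply: le_trans su; apply: ler_sum => j _.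
    rewrite powRr1// ler_piMr// powRN invf_le1 ?powR_gt0 ?powR_ge1//;
      have [h _] := hPhi k; have := h j; lra.
  pose eta := tt / (1 - x) - 1.
  have heta : (1 + eta) * (1 - x) = tt by rewrite /eta; field; rewrite subr_eq0 gt_eqF.
  have eta0 : 0 < eta by rewrite subr_gt0 ltr_pdivlMr ?subr_gt0//; lra.
  have [K K0 hK] := sum_powR_le eta0.
  exists (1 + K) => [|k s u us u0 su]; first lra.
  apply: le_trans (lerD su (hK _ _ (hPhi k) us)).
  rewrite -big_split; apply: ler_sum => j _ /=.
  have := @weighted_product_le_sum _ (u j) (Phi k j `^ (- (1 + eta))) x (u0 j) (powR_ge0 _ _).
  rewrite x0 (ltW x1) => /(_ isT); congr (_ * _ <= _).
  by rewrite -powRrM mulNr heta.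
exists K => s1 s2 u v us1 us2 u0 v0 su sv.
rewrite exchange_big /=; apply: (@le_trans _ _ (\sum_(k <- s2) v k * K)); last first.
  by rewrite -mulr_suml ler_piMl.
apply: ler_sum => k _; apply: le_trans (ler_wpM2l (v0 k) (hK k _ _ us1 u0 su)).
rewrite mulr_sumr; apply: ler_sum => j _.
by rewrite powRr1// mulrAC mulrC.
Qed.

(** The growing weight E_k^(1-mu) is split by the quasi-triangle inequality. Its [D] part cancels
    the kernel; its [E j] part leaves E_j^(1-mu-tt) D^(-(1-mu)), at most E_j^(-tt) if E_j <= D and
    at most D^(-tt) otherwise, as tt >= 1 - mu. *)
Lemma kernel_bounded_endpoint x sg tt : 0 <= x <= 1 -> sg = mu - 1 -> 0 <= sg + tt ->
  1 < x + tt -> kernel_bounded (weighted_kernel E D mu sg tt) x 1.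
Proof.
move=> x01 sgE st xt; case/andP: (mu01) => mu0 mu1.
have tt0 : 0 <= tt by lra.
apply: (@kernel_bounded_le _ _ _ (fun k j => E j `^ (- tt) + D k j `^ (- tt)) (2 * c `^ (1 - mu))).
- by rewrite mulr_ge0 ?powR_ge0.
- move=> k j; rewrite /weighted_kernel sgE opprB -mulrA.
  have hE : E k `^ (1 - mu) <= c `^ (1 - mu) * (E j `^ (1 - mu) + D k j `^ (1 - mu)).
    have := @ler_powRl _ (1 - mu) (E k) _ _ (ltW (E0 k)) (rs_E_le S k j).
    rewrite subr_ge0 (ltW mu1) => /(_ isT) /le_trans; apply.
    rewrite powRM ?(ltW c0)//; last by rewrite le_max (ltW (E0 j)).
    rewrite ler_wpM2l ?powR_ge0//; case: (leP (E j)) => _.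
      by rewrite lerDr powR_ge0.
    by rewrite lerDl powR_ge0.
  apply: le_trans (ler_wpM2r (mulr_ge0 (powR_ge0 _ _) (powR_ge0 _ _)) hE) _.
  rewrite -mulrA [leRHS]mulrAC [leRHS]mulrC ler_wpM2l ?powR_ge0//.
  have e1 : D k j `^ (1 - mu) * (E j `^ (- tt) * D k j `^ (- (1 - mu))) = E j `^ (- tt).
    by rewrite mulrCA -powRD ?(gt_eqF (D0 k j)) ?implybT// subrr powRr0 mulr1.
  have e2 : E j `^ (1 - mu) * (E j `^ (- tt) * D k j `^ (- (1 - mu))) <=
      E j `^ (- tt) + D k j `^ (- tt).
    rewrite mulrA -powRD ?(gt_eqF (E0 j)) ?implybT//.
    have [h|h] := leP (E j) (D k j).
      rewrite -[leLHS]addr0 lerD ?powR_ge0//.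
      apply: (@le_trans _ _ (E j `^ (1 - mu - tt) * E j `^ (- (1 - mu)))).
        rewrite ler_wpM2l ?powR_ge0// !powRN lef_pV2 ?posrE ?powR_gt0//.
        by rewrite ler_powRl ?(ltW (E0 j))// subr_ge0 ltW.
      by rewrite -powRD ?(gt_eqF (E0 j)) ?implybT// addrAC subrr add0r.
    rewrite -[leLHS]add0r lerD ?powR_ge0//.
    apply: (@le_trans _ _ (D k j `^ (1 - mu - tt) * D k j `^ (- (1 - mu)))).
      rewrite ler_wpM2r ?powR_ge0// -[1 - mu - tt]opprK !(powRN _ (- _)).
      rewrite lef_pV2 ?posrE ?powR_gt0//.
      by rewrite ler_powRl ?(ltW (D0 k j))// ?(ltW h)//; lra.
    by rewrite -powRD ?(gt_eqF (D0 k j)) ?implybT// addrAC subrr add0r.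
  by have := powR_ge0 (D k j) (- tt); rewrite mulrDl e1; lra.
- apply: kernel_boundedD; apply: kernel_bounded_sup => //.
Qed.

(** The first alternative, subcritical with its two endpoint exceptions, corresponds to [condC1] and
    [condC3]; the second, critical, to [condC4]. *)
Definition admissible x y sg tt := 0 <= sg + tt /\
  ([/\ 1 + mu < (x + tt) + (y + sg), mu < y + sg \/ (y = 1 /\ sg = mu - 1) &
       mu < x + tt \/ (x = 1 /\ tt = mu - 1)] \/
   [/\ (x + tt) + (y + sg) = 1 + mu, 1 <= x + y, x + tt < 1, y + sg < 1 &
       (sg + tt = 0 -> x < 1 /\ y < 1)]).

Lemma kernel_bounded_admissible x y sg tt : 0 <= x <= 1 -> 0 <= y <= 1 ->
  admissible x y sg tt -> kernel_bounded (weighted_kernel E D mu sg tt) x y.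
Proof.
move=> x01 y01 [st [[AB hA hB]|[AB xy hB hA hst]]]; last exact: (kernel_bounded_critical S mu01).
case: hA => [hA|[y1 sgE]]; last first.
  by rewrite y1; apply: kernel_bounded_endpoint => //; lra.
case: hB => [hB|[x1 ttE]]; first exact: kernel_bounded_subcritical.
apply: kernel_bounded_weighted_sym; rewrite x1.
by apply: kernel_bounded_endpoint => //; lra.
Qed.

End Sufficiency.

(** * Necessity *)

Section LogarithmicSets.
Context {R : realType} {T : eqType}.
Variables (c K : R) (Phi : T -> R).
Hypothesis K1 : 1 <= K.
Hypothesis countPhi : linear_count c Phi.

Lemma sum_inv_le (s : seq T) r : uniq s -> 0 < r ->
  (forall k, k \in s -> r < Phi k <= K * r) -> \sum_(k <- s) (Phi k)^-1 <= c * K.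
Proof.
move=> us r0 hs; have K0 : 0 < K := lt_le_trans ltr01 K1.
rewrite (_ : c * K = c * (K * r) * r^-1); last by field; rewrite gt_eqF.
(* [sum_le_count] needs a bound valid for every point of the ball and not only for members of [s];
   the minimum with 1/r supplies it. *)
rewrite (eq_big_seq (fun k => if Phi k <= K * r then Num.min (Phi k)^-1 r^-1 else 0)); last first.
  move=> k /hs /andP[h1 ->]; rewrite min_l// lef_pV2 ?posrE// ?ltW//; lra.
rewrite -big_mkcond; apply: (sum_le_count countPhi); rewrite ?mulr_gt0 ?invr_ge0 ?(ltW r0)//.
by move=> k ->; rewrite ge_min lexx orbT.
Qed.

(** A union of [M] disjoint annuli: each contributes to the sum of 1/Phi an amount bounded above and
    below, so the sum grows like the number of scales. *)
Lemma logarithmic_set (M : nat) :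
  (forall r, 1 <= r -> exists s, [/\ uniq s, r <= K * (size s)%:R &
    forall k, k \in s -> r < Phi k <= K * r]) ->
  exists s, [/\ uniq s, forall k, k \in s -> 1 < Phi k <= K ^+ M,
    (K * K)^-1 * M%:R <= \sum_(k <- s) (Phi k)^-1 & \sum_(k <- s) (Phi k)^-1 <= c * K * M%:R].
Proof.
move=> annulus; have K0 : 0 < K := lt_le_trans ltr01 K1.
elim: M => [|M [s [us hs lows ups]]].
  by exists [::]; split; rewrite ?big_nil ?mulr0.
have KM1 : 1 <= K ^+ M by rewrite exprn_ege1.
have KM0 : 0 < K ^+ M by lra.
have [t [ut sizet ht]] := annulus _ KM1.
exists (s ++ t); split.
- rewrite cat_uniq us ut andbT /=; apply/hasPn => k /ht /andP[h _].
  by apply/negP => /hs /andP[_]; rewrite leNgt h.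
- move=> k; rewrite mem_cat => /orP[/hs|/ht] /andP[h1 h2]; rewrite exprS; apply/andP; split => //.
  + by apply: le_trans h2 _; rewrite ler_peMl// ltW.
  + lra.
- rewrite big_cat -(natr1 M) mulrDr mulr1 lerD//.
  apply: (@le_trans _ _ (\sum_(k <- t) (K * K ^+ M)^-1)); last first.
    rewrite [leLHS]big_seq [leRHS]big_seq; apply: ler_sum => k /ht /andP[h1 h2].
    by rewrite lef_pV2 ?posrE ?mulr_gt0//; lra.
  rewrite big_const_seq count_predT iter_addr_0 -mulr_natl !invfM.
  have -> : (size t)%:R * (K^-1 * (K ^+ M)^-1) = K^-1 * ((size t)%:R / K ^+ M) by ring.
  rewrite ler_pM2l ?invr_gt0// ler_pdivlMr// ler_pdivrMl//.
- rewrite big_cat -(natr1 M) mulrDr mulr1 lerD// (@sum_inv_le t (K ^+ M))//.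
Qed.

End LogarithmicSets.

Section Necessity.
Context {R : realType} {T : eqType}.
Variables (E : T -> R) (D : T -> T -> R) (c : R).
Hypothesis S : regular_space E D c.
Variables (mu : R).
Hypothesis mu01 : 0 < mu < 1.
Implicit Types x y sg tt : R.

Let D0 k j : 0 < D k j. Proof. exact: lt_le_trans (rs_D_ge1 S k j). Qed.
Let E0 k : 0 < E k. Proof. exact: lt_le_trans (rs_E_ge1 S k). Qed.
Let c1 : 1 <= c. Proof. exact: rs_c_ge1 S. Qed.
Let c0 : 0 < c. Proof. exact: lt_le_trans (rs_c_ge1 S). Qed.
Let lnc0 : 0 <= ln c. Proof. by rewrite ln_ge0. Qed.

Let countE : linear_count c E.
Proof. by split; [exact: (rs_E_ge1 S)|exact: (rs_count_E S)]. Qed.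

Let countD j : linear_count c (D ^~ j).
Proof. by split => [k|]; [exact: (rs_D_ge1 S)|exact: (rs_count_D S)]. Qed.

(** The operator omits j = k, whereas [weighted_kernel] is positive there. *)
Definition off_diagonal (W : T -> T -> R) k j := if k == j then 0 else W k j.

Let K := c * c * c.
Let K1 : 1 <= K. Proof. by rewrite !mulr_ege1. Qed.
Let K0 : 0 < K. Proof. by rewrite !mulr_gt0. Qed.

(** Taken from the annulus of [D] of radius [c * r] about the origin, where [D] and [E] are
    comparable; this is where the cube of [c] comes from. *)
Lemma annulus_E r : 1 <= r -> exists s, [/\ uniq s, r <= K * (size s)%:R &
  forall k, k \in s -> r < E k <= K * r].
Proof.
move=> r1; have [z Ez] := rs_origin S.
have [s [us ss hs]] := @rs_annulus _ _ _ _ _ S z (c * r) (mulr_ege1 c1 r1).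
exists s; split => //.
  move: ss; rewrite ler_pM2l// => /le_trans; apply.
  by rewrite ler_peMl.
move=> k /hs /andP[h1 h2].
have := rs_D_le S k z; rewrite Ez max_l ?(rs_E_ge1 S)// => h3.
have := rs_E_le S k z; rewrite Ez max_r ?(rs_D_ge1 S)// => h4.
rewrite -(ltr_pM2l c0) (lt_le_trans h1 h3)/= (le_trans h4)//.
by rewrite /K -!mulrA ler_pM2l.
Qed.

Lemma E_unbounded r : exists k, r < E k.
Proof.
have r1 : 1 <= Num.max 1 r by rewrite le_max lexx.
have [ [|k s] [_ h1 h2]] := annulus_E r1; first by move: h1; rewrite mulr0; lra.
exists k; have /andP[h _] := h2 k (mem_head _ _).
by apply: le_lt_trans h; rewrite le_max lexx orbT.
Qed.

Lemma kernel_bounded_homogeneous W x y : kernel_bounded W x y ->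
  exists2 C, 0 <= C & forall s1 s2 (phi psi : T -> R) (m1 m2 : R), uniq s1 -> uniq s2 ->
    (forall j, 0 <= phi j) -> (forall k, 0 <= psi k) -> 0 < m1 -> 0 < m2 ->
    \sum_(j <- s1) phi j <= m1 -> \sum_(k <- s2) psi k <= m2 ->
    \sum_(j <- s1) \sum_(k <- s2) phi j `^ x * psi k `^ y * W k j <= C * (m1 `^ x * m2 `^ y).
Proof.
move=> [C hC]; exists (Num.max 0 C) => [|s1 s2 phi psi m1 m2 us1 us2 phi0 psi0 m10 m20 s1m s2m].
  by rewrite le_max lexx.
have := hC s1 s2 (fun j => phi j / m1) (fun k => psi k / m2) us1 us2.
have h1 j : 0 <= phi j / m1 by rewrite divr_ge0// ltW.
have h2 k : 0 <= psi k / m2 by rewrite divr_ge0// ltW.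
move=> /(_ h1 h2); rewrite -!mulr_suml !ler_pdivrMr// !mul1r => /(_ s1m s2m) h.
have mm : 0 < m1 `^ x * m2 `^ y by rewrite mulr_gt0 ?powR_gt0.
rewrite -ler_pdivrMr//; apply: (@le_trans _ _ C); last by rewrite le_max lexx orbT.
apply: le_trans h; rewrite mulr_suml; apply: ler_sum => j _.
rewrite mulr_suml; apply: ler_sum => k _.
rewrite !powRM ?invr_ge0 ?(ltW m10) ?(ltW m20)//.
rewrite (powRV _ (ltW m10)) (powRV _ (ltW m20)).
by rewrite le_eqVlt; apply/orP; left; apply/eqP; field; rewrite !gt_eqF ?powR_gt0.
Qed.

Lemma off_diagonal_sym x y sg tt :
  kernel_bounded (off_diagonal (weighted_kernel E D mu sg tt)) x y ->
  kernel_bounded (off_diagonal (weighted_kernel E D mu tt sg)) y x.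
Proof.
move=> /kernel_bounded_swap; apply: kernel_bounded_le ler01 _ => k j.
by rewrite mul1r /off_diagonal eq_sym (weighted_kernel_sym S).
Qed.

Lemma point_mass_test x y sg tt :
  kernel_bounded (off_diagonal (weighted_kernel E D mu sg tt)) x y ->
  exists2 C, 0 <= C & forall j s (psi : T -> R) (m : R), uniq s -> (forall k, 0 <= psi k) ->
    0 < m -> \sum_(k <- s) psi k <= m -> j \notin s ->
    \sum_(k <- s) psi k `^ y * weighted_kernel E D mu sg tt k j <= C * m `^ y.
Proof.
move=> /kernel_bounded_homogeneous[C C0 hC]; exists C => // j s psi m us psi0 m0 sm js.
have := hC [:: j] s (fun=> 1) psi 1 m isT us (fun=> ler01) psi0 ltr01 m0.
rewrite !big_seq1 lexx powR1 mul1r => /(_ isT sm); apply: le_trans.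
rewrite [leLHS]big_seq [leRHS]big_seq; apply: ler_sum => k ks.
by rewrite /off_diagonal mul1r; case: eqP ks js => // -> ->.
Qed.

(** Two distinct points at bounded distance, far from the origin, see a kernel of order
    E_j^(-(sg+tt)), which is unbounded if sg + tt < 0. *)
Lemma necessary_weights x y sg tt :
  kernel_bounded (off_diagonal (weighted_kernel E D mu sg tt)) x y -> 0 <= sg + tt.
Proof.
move=> /point_mass_test[C C0 hC]; case/andP: (mu01) => mu0 mu1.
rewrite leNgt; apply/negP => st; have st' : 0 < - (sg + tt) by lra.
pose a := expR (- (`|sg| * ln (c * c) + (1 - mu) * ln c)).
have [b b1 hb] := powR_unbounded (C / a) st'.
have [j jb] := E_unbounded b.
have [ [|k s] [us ss hs]] := @rs_annulus _ _ _ _ _ S j 1 (lexx _).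
  by move: ss; rewrite mulr0; lra.
have /andP[Dk1 Dk2] := hs k (mem_head _ _).
have jk : j \notin [:: k].
  by rewrite inE; apply/eqP => jk; move: Dk1; rewrite jk (rs_D_diag S) ltxx.
have := hC j [:: k] (fun=> 1) 1 isT (fun=> ler01) ltr01.
rewrite !big_seq1 powR1 mulr1 mul1r lexx => /(_ isT jk).
apply/negP; rewrite -ltNge; have := hb _ (ltW jb).
rewrite ltr_pdivrMr ?expR_gt0// => /lt_le_trans; apply.
have cc0 : 0 < c * c by rewrite mulr_gt0.
have cE k' : c <= c * E k' by rewrite ler_peMr// ?(rs_E_ge1 S)// ltW.
have Ekj : E k <= c * c * E j.
  apply: le_trans (rs_E_le S k j) _; rewrite -mulrA ler_wpM2l ?(ltW c0)//.
  by rewrite ge_max ler_peMl ?(ltW (E0 j))//= (le_trans Dk2)// mulr1.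
have Ejk : E j <= c * c * E k.
  apply: le_trans (rs_E_le S j k) _; rewrite -mulrA ler_wpM2l ?(ltW c0)//.
  by rewrite ge_max ler_peMl ?(ltW (E0 k))//= (rs_D_sym S) (le_trans Dk2)// mulr1.
have := near_powR sg cc0 (E0 k) (E0 j) Ekj Ejk.
have : (1 - mu) * ln (D k j) <= (1 - mu) * ln c.
  by rewrite ler_wpM2l ?subr_ge0 ?(ltW mu1)// ler_ln ?posrE//; lra.
rewrite /weighted_kernel /a !powR_expR// -!expRD ler_expR; lra.
Qed.

(** A unit mass at the origin produces a function of order at least E_k^(-sg-(1-mu)). If y < 1 and y
    + sg <= mu, pairing with (1/E)^y over [M] scales gives at least a multiple of [M] against M^y.
    If y = 1, a single far point forces sg >= mu - 1. *)
Lemma necessary_local_integrability x y sg tt : 0 <= y <= 1 ->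
  kernel_bounded (off_diagonal (weighted_kernel E D mu sg tt)) x y ->
  mu < y + sg \/ (y = 1 /\ sg = mu - 1).
Proof.
move=> /andP[y0 y1] /point_mass_test[C C0 hC]; case/andP: (mu01) => mu0 mu1.
have [z Ez] := rs_origin S.
have [hA|hA] := ltP mu (y + sg); [by left|right].
pose a := expR (- ((1 - mu) * ln c)).
have test s psi m : uniq s -> (forall k, 0 <= psi k) -> 0 < m -> \sum_(k <- s) psi k <= m ->
    (forall k, k \in s -> 1 < E k) ->
    \sum_(k <- s) psi k `^ y * (a * E k `^ (- sg - (1 - mu))) <= C * m `^ y.
  move=> us psi0 m0 sm hs; have zs : z \notin s by apply/negP => /hs; rewrite Ez ltxx.
  apply: le_trans (hC z s psi m us psi0 m0 sm zs); apply: ler_sum => k _.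
  rewrite ler_wpM2l ?powR_ge0// /weighted_kernel Ez powR1 mulr1.
  have := rs_D_le S k z; rewrite Ez max_l ?(rs_E_ge1 S)// => h.
  have : (1 - mu) * ln (D k z) <= (1 - mu) * (ln c + ln (E k)).
    by rewrite ler_wpM2l ?subr_ge0 ?(ltW mu1)// -lnM ?posrE// ler_ln ?posrE ?mulr_gt0.
  rewrite !powR_expR// -!expRD ler_expR; lra.
move: y1; rewrite le_eqVlt => /predU1P[yE|y1].
  split => //; apply/le_anti/andP; split; first lra.
  rewrite leNgt; apply/negP => sgl; have sg' : 0 < - sg - (1 - mu) by lra.
  have [b b1 hb] := powR_unbounded (C / a) sg'.
  have [k kb] := E_unbounded b.
  have := test [:: k] (fun=> 1) 1 isT (fun=> ler01) ltr01.
  rewrite !big_seq1 powR1 mulr1 mul1r lexx => /(_ isT) h.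
  have hs k' : k' \in [:: k] -> 1 < E k' by rewrite inE => /eqP ->; lra.
  have := h hs; rewrite leNgt; have := hb _ (ltW kb).
  by rewrite ltr_pdivrMr ?expR_gt0// mulrC => ->.
exfalso; apply: (@powR_sublinear _ (a * (K * K)^-1) (C * (c * K) `^ y) y) => //.
  by rewrite mulr_gt0 ?expR_gt0 ?invr_gt0 ?mulr_gt0.
move=> M M0; have [s [us hs lows ups]] := logarithmic_set K1 countE M annulus_E.
have M0' : 0 < M%:R :> R by rewrite ltr0n.
have cKM : 0 < c * K * M%:R by rewrite !mulr_gt0.
have := test s (fun k => (E k)^-1) _ us _ cKM ups.
have i0 k : 0 <= (E k)^-1 by rewrite invr_ge0 ltW.
have s1 k : k \in s -> 1 < E k by move=> /hs /andP[].
have cK0 : 0 <= c * K by rewrite ltW// mulr_gt0.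
move=> /(_ i0 s1); rewrite (powRM _ cK0 (ltW M0')) mulrA; apply: le_trans.
rewrite -mulrA; apply: le_trans (ler_wpM2l (expR_ge0 _) lows) _.
rewrite mulr_sumr; apply: ler_sum => k _.
rewrite mulrCA ler_wpM2l ?expR_ge0// -(powR_inv1 (ltW (E0 k))) -powRrM.
rewrite -powRD ?(gt_eqF (E0 k)) ?implybT// ler_powR ?(rs_E_ge1 S)//; lra.
Qed.

(** A unit mass at [j] is tested against 1/Phi over [M] scales. The point [j] may depend on [M], so
    it can be placed beyond all of them. *)
Lemma point_mass_logarithmic_absurd x y sg tt (Phi : T -> T -> R) (L a : R) :
  kernel_bounded (off_diagonal (weighted_kernel E D mu sg tt)) x y -> y < 1 -> 1 <= L -> 0 < a ->
  (forall j, linear_count c (Phi j)) ->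
  (forall j r, 1 <= r -> exists s, [/\ uniq s, r <= L * (size s)%:R &
    forall k, k \in s -> r < Phi j k <= L * r]) ->
  ~ (forall M : nat, exists j, forall k, 1 < Phi j k <= L ^+ M ->
    k != j /\ a * (Phi j k)^-1 <= (Phi j k) `^ (- y) * weighted_kernel E D mu sg tt k j).
Proof.
move=> /point_mass_test[C C0 hC] y1 L1 a0 cnt annulus far.
have L0 : 0 < L := lt_le_trans ltr01 L1.
have LL0 : 0 < (L * L)^-1 by rewrite invr_gt0 mulr_gt0.
have cL0 : 0 < c * L by rewrite mulr_gt0.
apply: (@powR_sublinear _ (a * (L * L)^-1) (C * (c * L) `^ y) y (mulr_gt0 a0 LL0) y1) => M M0.
have [j hj] := far M.
have [s [us hs lows ups]] := logarithmic_set L1 (cnt j) M (annulus j).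
have M0' : 0 < M%:R :> R by rewrite ltr0n.
have P0 k : 0 < Phi j k by have [h _] := cnt j; exact: lt_le_trans (h k).
have i0 k : 0 <= (Phi j k)^-1 by rewrite invr_ge0 ltW.
have js : j \notin s by apply/negP => /hs /hj[]; rewrite eqxx.
have := hC j s (fun k => (Phi j k)^-1) _ us i0 (mulr_gt0 cL0 M0') ups js.
rewrite (powRM _ (ltW cL0) (ltW M0')) mulrA; apply: le_trans.
rewrite -mulrA; apply: le_trans (ler_wpM2l (ltW a0) lows) _; rewrite mulr_sumr.
rewrite [leLHS]big_seq [leRHS]big_seq; apply: ler_sum => k /hs /hj[_].
by rewrite powRN powRV// ltW.
Qed.

(** If y + sg >= 1 then x + tt <= mu, so the mirrored endpoint holds: x = 1, tt = mu - 1 and y + sg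
    = 1. For [j] beyond all scales E_j^(1-mu) offsets D^(-(1-mu)), and E_k^(-y-sg) = 1/E_k diverges
    logarithmically. *)
Lemma necessary_critical_strict x y sg tt : 0 <= x <= 1 ->
  kernel_bounded (off_diagonal (weighted_kernel E D mu sg tt)) x y ->
  (x + tt) + (y + sg) = 1 + mu -> y + sg < 1.
Proof.
move=> x01 BL AB; case/andP: (mu01) => mu0 mu1.
have st := necessary_weights BL.
rewrite ltNge; apply/negP => hA.
case: (necessary_local_integrability x01 (off_diagonal_sym BL)) => [|[xE ttE]]; first lra.
pose a := expR (- ((1 - mu) * ln c)).
apply: (@point_mass_logarithmic_absurd x y sg tt (fun=> E) K a BL) => //.
- lra.
- exact: expR_gt0.
- by move=> j r; exact: annulus_E.
move=> M; have [j hj] := E_unbounded (K ^+ M); exists j => k /andP[k1 kM].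
have Ekj : E k < E j := le_lt_trans kM hj.
split; first by apply/eqP => kj; move: Ekj; rewrite kj ltxx.
have := rs_D_le S k j; rewrite max_r ?(ltW Ekj)// => h.
have : (1 - mu) * ln (D k j) <= (1 - mu) * (ln c + ln (E j)).
  by rewrite ler_wpM2l ?subr_ge0 ?(ltW mu1)// -lnM ?posrE// ler_ln ?posrE ?mulr_gt0.
rewrite /weighted_kernel /a -(powR_inv1 (ltW (E0 k))) !powR_expR// -!expRD ler_expR ttE.
have -> : y = 1 - sg by lra.
lra.
Qed.

(** If x = 1 then y = mu. In a ball about a sufficiently remote [j] the weights cancel, and D^(-mu)
    D^(-(1-mu)) = 1/D diverges logarithmically. *)
Lemma necessary_no_endpoint x y sg tt : 0 <= x <= 1 ->
  kernel_bounded (off_diagonal (weighted_kernel E D mu sg tt)) x y ->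
  (x + tt) + (y + sg) = 1 + mu -> sg + tt = 0 -> x < 1.
Proof.
move=> /andP[x0 x1] BL AB st; case/andP: (mu01) => mu0 mu1.
rewrite lt_neqAle x1 andbT; apply/eqP => xE.
pose a := expR (- (`|sg| * ln c)).
apply: (@point_mass_logarithmic_absurd x y sg tt (fun j => D ^~ j) c a BL) => //.
- lra.
- exact: expR_gt0.
- by move=> j r; exact: (rs_annulus S).
move=> M; have [j hj] := E_unbounded (c * c ^+ M); exists j => k /andP[k1 kM].
split; first by apply/eqP => kj; move: k1; rewrite kj (rs_D_diag S) ltxx.
have Dj : c * D k j < E j by apply: le_lt_trans hj; rewrite ler_pM2l.
have Ejk : E j <= c * E k.
  have := rs_E_le S j k; rewrite (rs_D_sym S) maxr_pMr ?(ltW c0)// le_max => /orP[//|].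
  by rewrite leNgt Dj.
have DE : D k j <= E j by apply: le_trans (ltW Dj); rewrite ler_peMl ?(ltW (D0 k j)).
have Ekj : E k <= c * E j by have := rs_E_le S k j; rewrite max_l.
have := near_powR sg c0 (E0 k) (E0 j) Ekj Ejk.
rewrite /weighted_kernel /a -(powR_inv1 (ltW (D0 k j))) !powR_expR// -!expRD ler_expR.
have -> : tt = - sg by lra.
have -> : y = mu by lra.
lra.
Qed.

(** The weighted kernel after both test families, equal to 1/E, have been absorbed into its
    exponents. *)
Let pair_kernel A B k j := if k == j then 0 else
  E j `^ (- B) * E k `^ (- A) * D k j `^ (- (1 - mu)).

Let pair_kernel_ge0 A B k j : 0 <= pair_kernel A B k j.
Proof. by rewrite /pair_kernel; case: ifP => // _; rewrite !mulr_ge0 ?powR_ge0. Qed.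

Lemma pair_test x y sg tt :
  kernel_bounded (off_diagonal (weighted_kernel E D mu sg tt)) x y ->
  exists2 C, 0 <= C & forall s m, uniq s -> 0 < m -> \sum_(k <- s) (E k)^-1 <= m ->
    \sum_(j <- s) \sum_(k <- s) pair_kernel (y + sg) (x + tt) k j <= C * (m `^ x * m `^ y).
Proof.
move=> /kernel_bounded_homogeneous[C C0 hC]; exists C => // s m us m0 sm.
have i0 k : 0 <= (E k)^-1 by rewrite invr_ge0 ltW.
apply: le_trans (hC s s _ _ m m us us i0 i0 m0 m0 sm sm).
apply: ler_sum => j _; apply: ler_sum => k _.
rewrite /pair_kernel /off_diagonal; case: ifP => _; first by rewrite mulr0.
rewrite /weighted_kernel -!powR_inv1 ?(ltW (E0 _))// -!powRrM !powR_expR// -!expRD ler_expR.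
lra.
Qed.

(** Two consecutive annuli at radius [r] are disjoint, so the diagonal is avoided. They provide
    about r^2 pairs, each of size at least a multiple of r^(-A-B-(1-mu)). *)
Lemma pair_sum_ge A B : exists2 a, 0 < a & forall r, 1 <= r -> exists s,
  [/\ uniq s, forall k, k \in s -> r < E k <= K * (K * r),
    \sum_(k <- s) (E k)^-1 <= 2 * (c * K) &
    a * r `^ (1 + mu - A - B) <= \sum_(j <- s) \sum_(k <- s) pair_kernel A B k j].
Proof.
case/andP: (mu01) => mu0 mu1.
(* The three terms are the cost of replacing [E j], [E k] and [D k j] by [r]. *)
pose m := `|B| * ln K + `|A| * (2 * ln K) + (1 - mu) * (ln c + 2 * ln K).
exists (K^-1 * expR (- m)) => [|r r1]; first by rewrite mulr_gt0 ?invr_gt0 ?expR_gt0.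
have r0 : 0 < r := lt_le_trans ltr01 r1.
have [s1 [us1 ss1 hs1]] := annulus_E r1.
have Kr1 : 1 <= K * r by rewrite mulr_ege1.
have [s2 [us2 ss2 hs2]] := annulus_E Kr1.
have Kr0 : 0 < K * r by rewrite mulr_gt0.
have rKr : r <= K * r by rewrite ler_peMl ?(ltW r0).
have KrKr : K * r <= K * (K * r) by rewrite ler_pM2l.
exists (s1 ++ s2); split.
- rewrite cat_uniq us1 us2 andbT /=; apply/hasPn => k /hs2 /andP[h _].
  by apply/negP => /hs1 /andP[_]; rewrite leNgt h.
- move=> k; rewrite mem_cat => /orP[/hs1|/hs2] /andP[h1 h2]; apply/andP; split => //.
  + exact: le_trans h2 KrKr.
  + exact: le_lt_trans rKr h1.
- rewrite big_cat mulr_natl mulr2n /= lerD//.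
  + exact: (@sum_inv_le _ _ _ _ _ K1 countE s1 r).
  + exact: (@sum_inv_le _ _ _ _ _ K1 countE s2 (K * r)).
apply: (@le_trans _ _ (\sum_(j <- s1) \sum_(k <- s2) expR (- m) * r `^ (- A - B - (1 - mu)))).
  rewrite big_const_seq count_predT iter_addr_0 big_const_seq count_predT iter_addr_0.
  rewrite -[_ *+ size s1]mulr_natl -[_ *+ size s2]mulr_natl.
  have -> : r `^ (1 + mu - A - B) = r * r * r `^ (- A - B - (1 - mu)).
    rewrite -{2 3}(powRr1 (ltW r0)) -!powRD ?(gt_eqF r0) ?implybT//; congr (_ `^ _); ring.
  set w := expR _; set z := r `^ _.
  have wz : 0 <= w * z by rewrite mulr_ge0 ?expR_ge0 ?powR_ge0.
  rewrite [leLHS](_ : _ = (r / K) * (r * (w * z))); last by ring.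
  have s1r : r / K <= (size s1)%:R by rewrite ler_pdivrMr// mulrC.
  have s2r : r <= (size s2)%:R by rewrite -(ler_pM2l K0).
  apply: ler_pM => //.
  - by rewrite divr_ge0 ?(ltW r0) ?(ltW K0).
  - by rewrite mulr_ge0 ?(ltW r0).
  - by rewrite ler_wpM2r.
rewrite big_cat /= -[leLHS]addr0 lerD//; last first.
  by rewrite sumr_ge0// => j _; rewrite sumr_ge0// => k _.
rewrite [leLHS]big_seq [leRHS]big_seq; apply: ler_sum => j js.
rewrite big_cat /= -[leLHS]add0r lerD//; first by rewrite sumr_ge0// => k _.
rewrite [leLHS]big_seq [leRHS]big_seq; apply: ler_sum => k ks.
have /andP[j1 j2] := hs1 _ js; have /andP[k1 k2] := hs2 _ ks.
have jk : E j < E k := le_lt_trans j2 k1.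
rewrite /pair_kernel; case: eqP => [kj|_]; first by move: jk; rewrite kj ltxx.
have lnK1 : 0 <= ln K by rewrite ln_ge0.
have lj1 : ln r <= ln (E j) by rewrite ler_ln ?posrE// ltW.
have lj2 : ln (E j) <= ln K + ln r by rewrite -lnM ?posrE// ler_ln ?posrE.
have lk1 : ln r <= ln (E k) by rewrite ler_ln ?posrE// (le_trans rKr)// ltW.
have lk2 : ln (E k) <= ln K + (ln K + ln r).
  by rewrite -[ln K + ln r]lnM ?posrE// -lnM ?posrE// ler_ln ?posrE// mulr_gt0.
have ld : ln (D k j) <= ln c + ln (E k).
  rewrite -lnM ?posrE// ler_ln ?posrE ?mulr_gt0//.
  by have := rs_D_le S k j; rewrite max_l ?(ltW jk).
have hB : B * (ln (E j) - ln r) <= `|B| * ln K.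
  apply: (@le_trans _ _ (`|B| * (ln (E j) - ln r))).
    by rewrite ler_wpM2r ?subr_ge0// ler_norm.
  by rewrite ler_wpM2l//; lra.
have hA : A * (ln (E k) - ln r) <= `|A| * (2 * ln K).
  apply: (@le_trans _ _ (`|A| * (ln (E k) - ln r))).
    by rewrite ler_wpM2r ?subr_ge0// ler_norm.
  by rewrite ler_wpM2l//; lra.
have hD : (1 - mu) * (ln (D k j) - ln r) <= (1 - mu) * (ln c + 2 * ln K).
  by rewrite ler_wpM2l ?subr_ge0 ?(ltW mu1)//; lra.
rewrite !powR_expR// -!expRD ler_expR /m; lra.
Qed.

(** Otherwise the pair sum grows as a positive power of [r] while the masses stay bounded. *)
Lemma necessary_scaling x y sg tt :
  kernel_bounded (off_diagonal (weighted_kernel E D mu sg tt)) x y ->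
  1 + mu <= (x + tt) + (y + sg).
Proof.
move=> /pair_test[C C0 hC]; rewrite leNgt; apply/negP => AB.
have [a a0 ha] := pair_sum_ge (y + sg) (x + tt).
have e0 : 0 < 1 + mu - (y + sg) - (x + tt) by lra.
pose m := 2 * (c * K); have m0 : 0 < m by rewrite !mulr_gt0.
have [b b1 hb] := powR_unbounded (C * (m `^ x * m `^ y) / a) e0.
have [s [us _ sm low]] := ha b b1.
have := le_trans low (hC s m us m0 sm).
by apply/negP; rewrite -ltNge (mulrC a) -ltr_pdivrMr// hb.
Qed.

(** In the critical case each block of two annuli contributes a constant. Only pairs inside one
    block are counted, and the blocks are disjoint with ratio [K * K]. *)
Lemma pair_logarithmic_set A B : A + B = 1 + mu -> exists2 a, 0 < a & forall M : nat, exists s,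
  [/\ uniq s, forall k, k \in s -> 1 < E k <= (K * K) ^+ M,
    \sum_(k <- s) (E k)^-1 <= 2 * (c * K) * M%:R &
    a * M%:R <= \sum_(j <- s) \sum_(k <- s) pair_kernel A B k j].
Proof.
move=> AB; have [a a0 ha] := pair_sum_ge A B; exists a => //.
elim=> [|M [s [us hs sm low]]]; first by exists [::]; split; rewrite ?big_nil ?mulr0.
have KM1 : 1 <= (K * K) ^+ M by rewrite exprn_ege1// mulr_ege1.
have [t [ut ht tm lowt]] := ha _ KM1.
exists (s ++ t); split.
- rewrite cat_uniq us ut andbT /=; apply/hasPn => k /ht /andP[h _].
  by apply/negP => /hs /andP[_]; rewrite leNgt h.
- move=> k; rewrite mem_cat exprS -mulrA => /orP[/hs|/ht] /andP[h1 h2]; apply/andP; split => //.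
  + apply: le_trans h2 _; rewrite mulrA ler_peMl ?mulr_ege1//.
    exact: le_trans ler01 KM1.
  + exact: le_lt_trans KM1 h1.
- by rewrite big_cat -(natr1 M) mulrDr mulr1 lerD.
rewrite big_cat -(natr1 M) mulrDr mulr1 /= lerD//.
  apply: le_trans low _; apply: ler_sum => j _.
  by rewrite big_cat /= lerDl sumr_ge0// => k _.
rewrite (_ : a = a * ((K * K) ^+ M) `^ (1 + mu - A - B)); last first.
  have -> : 1 + mu - A - B = 0 by lra.
  by rewrite powRr0 mulr1.
apply: le_trans lowt _; apply: ler_sum => j _.
by rewrite big_cat /= lerDr sumr_ge0// => k _.
Qed.

(** Over [M] blocks the form is at least of order [M], while both masses are of order [M], which
    permits only M^(x+y). *)
Lemma necessary_exponents x y sg tt :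
  kernel_bounded (off_diagonal (weighted_kernel E D mu sg tt)) x y ->
  (x + tt) + (y + sg) = 1 + mu -> 1 <= x + y.
Proof.
move=> /pair_test[C C0 hC] AB; rewrite leNgt; apply/negP => xy1.
have [|a a0 ha] := @pair_logarithmic_set (y + sg) (x + tt); first lra.
pose m := 2 * (c * K); have m0 : 0 < m by rewrite !mulr_gt0.
apply: (@powR_sublinear _ a (C * (m `^ x * m `^ y)) (x + y) a0 xy1) => M M0.
have M0' : 0 < M%:R :> R by rewrite ltr0n.
have [s [us _ sm low]] := ha M.
apply: le_trans low _; apply: le_trans (hC s _ us (mulr_gt0 m0 M0') sm) _.
rewrite !(powRM _ (ltW m0) (ltW M0')) powRD ?(gt_eqF M0') ?implybT//.
by rewrite le_eqVlt; apply/orP; left; apply/eqP; ring.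
Qed.

Lemma admissible_necessary x y sg tt : 0 <= x <= 1 -> 0 <= y <= 1 ->
  kernel_bounded (off_diagonal (weighted_kernel E D mu sg tt)) x y ->
  admissible mu x y sg tt.
Proof.
move=> x01 y01 BL; have BL' := off_diagonal_sym BL.
split; first exact: necessary_weights BL.
have := necessary_scaling BL; rewrite le_eqVlt => /predU1P[AB|AB]; [right|left]; split.
- by [].
- exact: necessary_exponents BL (esym AB).
- by apply: necessary_critical_strict BL' _ => //; lra.
- by apply: necessary_critical_strict BL _ => //; lra.
- move=> st; split; first by apply: necessary_no_endpoint BL _ st => //; lra.
  by apply: necessary_no_endpoint BL' _ _ => //; lra.
- by [].
- exact: necessary_local_integrability BL.
- exact: necessary_local_integrability BL'.
Qed.

End Necessity.

(** * The integer lattice *)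

Section IntegerLattice.
Context {R : realType} {n : nat}.
Hypothesis n_gt0 : (0 < n)%N.
Implicit Types k j : Zn n.

Lemma sqnorm_ge0 k : 0 <= sqnorm R k.
Proof. by apply: sumr_ge0 => i _; rewrite sqr_ge0. Qed.

Lemma sqnormN k : sqnorm R (- k) = sqnorm R k.
Proof. by apply: eq_bigr => i _; rewrite mxE rmorphN sqrrN. Qed.

Lemma sqnorm_sub_sym k j : sqnorm R (k - j) = sqnorm R (j - k).
Proof. by rewrite -sqnormN opprB. Qed.

Lemma sqnormD_le k j : sqnorm R (k + j) <= 2 * sqnorm R k + 2 * sqnorm R j.
Proof.
rewrite !mulr_sumr -big_split; apply: ler_sum => i _; rewrite mxE rmorphD /=.
set a := _%:~R; set b := _%:~R; have := sqr_ge0 (a - b); lra.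
Qed.

Lemma sqnorm_coord k i : ((k ord0 i)%:~R : R) ^+ 2 <= sqnorm R k.
Proof. by rewrite /sqnorm (bigD1 i)//= lerDl sumr_ge0// => l _; rewrite sqr_ge0. Qed.

Lemma sqnorm_ge1 k : k != 0 -> 1 <= sqnorm R k.
Proof.
move=> k0; have [i ki] : exists i, k ord0 i != 0.
  apply/existsP; apply: contraNT k0; rewrite negb_exists => /forallP h.
  by apply/eqP/rowP => i; rewrite mxE; apply/eqP; have := h i; rewrite negbK.
apply: le_trans (sqnorm_coord k i).
rewrite -rmorphXn /= -[1]/(1%:~R) ler_int; move: (k ord0 i) ki => z.
by rewrite -sqrf_eq0 => z0; have := sqr_ge0 z; lia.
Qed.

Let h : R := n%:R / 2.
Let h_gt0 : 0 < h. Proof. by rewrite divr_gt0 ?ltr0n. Qed.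
Let h_ge0 : 0 <= h := ltW h_gt0.

Definition lattice_weight k : R := (1 + sqnorm R k) `^ h.
Definition lattice_dist k j : R := Num.max 1 (sqnorm R (k - j)) `^ h.
(** One constant for all the axioms; the outer radius of the annuli is what requires [16 * n]. *)
Definition lattice_const : R := (16 * n%:R) `^ h.

(** Shifting the coordinates by [M] injects the list into the functions from ['I_n] to
    ['I_(2 * M).+1]. *)
Lemma box_count (s : seq (Zn n)) (M : nat) : uniq s ->
  (forall k, k \in s -> forall i, `|k ord0 i| <= M%:Z) -> (size s <= (2 * M).+1 ^ n)%N.
Proof.
move=> us hs.
pose f k := [ffun i : 'I_n => (inord (absz (k ord0 i + M%:Z)) : 'I_(2 * M).+1)].
have inj : {in s &, injective f}.
  move=> k l ks ls /ffunP kl; apply/rowP => i; have := kl i; rewrite !ffunE.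
  have := hs _ ks i; have := hs _ ls i; move: (k ord0 i) (l ord0 i) => a b hb ha.
  by move=> /(congr1 val) /=; rewrite !inordK; lia.
have := map_inj_in_uniq inj; rewrite us => /card_uniqP => h1.
rewrite -(size_map f) -h1; apply: leq_trans (max_card _) _.
by rewrite card_ffun !card_ord.
Qed.

Lemma powR_half (a : R) : 0 <= a -> a ^+ n = (a ^+ 2) `^ h.
Proof.
move=> a0; rewrite -!powR_mulrn// -powRrM; congr (_ `^ _).
by rewrite /h mulrC divfK.
Qed.

Lemma powR_inv_half (r : R) : 0 < r -> exists2 q, 0 < q & r = q `^ h.
Proof.
move=> r0; exists (r `^ h^-1); first exact: powR_gt0.
by rewrite -powRrM mulVf ?gt_eqF// powRr1// ltW.
Qed.

Lemma powR_half_le (a b : R) : 0 <= a -> 0 <= b -> (a `^ h <= b `^ h) = (a <= b).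
Proof.
move=> a0 b0; apply/idP/idP => [|ab]; last exact: ler_powRl.
by apply: contraTT; rewrite -!ltNge => ba; rewrite gt0_ltr_powR.
Qed.

Lemma powR_half_max (a b : R) : 0 <= a -> 0 <= b ->
  Num.max a b `^ h = Num.max (a `^ h) (b `^ h).
Proof.
move=> a0 b0; case: (leP a b) => ab; first by rewrite max_r// powR_half_le.
by rewrite max_l// powR_half_le// ltW.
Qed.

Lemma ball_count (s : seq (Zn n)) (q : R) : uniq s -> 1 <= q ->
  (forall k, k \in s -> sqnorm R k <= q) -> (size s)%:R <= lattice_const * q `^ h.
Proof.
move=> us q1 hs; have q0 : 0 <= q by lra.
have sq0 : 0 <= Num.sqrt q := sqrtr_ge0 _.
have sq1 : 1 <= Num.sqrt q by rewrite -sqrtr1 ler_wsqrtr.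
have := truncn_itv sq0; move: (Num.truncn _) => M /andP[M1 M2].
have hM k : k \in s -> forall i, `|k ord0 i| <= M%:Z.
  move=> /hs kq i; have := le_trans (sqnorm_coord k i) kq.
  rewrite -ler_sqrt// sqrtr_sqr => /le_lt_trans/(_ M2).
  by rewrite -intr_norm [M.+1%:R]pmulrn ltr_int (intS M) addrC ltzD1.
have := box_count us hM; rewrite -(ler_nat R) => /le_trans; apply.
rewrite natrX; apply: (@le_trans _ _ ((3 * Num.sqrt q) ^+ n)).
  by rewrite lerXn2r ?nnegrE ?mulr_ge0// -natr1 natrM; lra.
have n1 : 1 <= n%:R :> R by rewrite ler1n.
rewrite powR_half ?mulr_ge0// -powRM ?mulr_ge0// powR_half_le ?sqr_ge0 ?mulr_ge0//.
rewrite exprMn sqr_sqrtr// ler_wpM2r//; lra.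
Qed.

Lemma lattice_regular : regular_space lattice_weight lattice_dist lattice_const.
Proof.
have n1 : 1 <= n%:R :> R by rewrite ler1n.
have s0 := sqnorm_ge0; have m0 (a : R) : 0 <= Num.max 1 a by rewrite le_max ler01.
have m1 (a : R) : 1 <= Num.max 1 a by rewrite le_max lexx.
have n16 : 0 <= 16 * n%:R :> R by lra.
have s1 k : 0 <= 1 + sqnorm R k by have := s0 k; lra.
split.
- by rewrite powR_ge1//; lra.
- by move=> k; rewrite powR_ge1//; have := s0 k; lra.
- by move=> k j; rewrite powR_ge1.
- move=> j; rewrite /lattice_dist subrr /sqnorm big1 ?max_l ?powR1// => i _.
  by rewrite mxE expr0n.
- by move=> k j; rewrite /lattice_dist sqnorm_sub_sym.
- move=> k j; rewrite /lattice_weight /lattice_dist /lattice_const -powR_half_max//.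
  set m := Num.max _ _.
  have ma : 1 + sqnorm R j <= m by rewrite le_max lexx.
  have mb : sqnorm R (k - j) <= m by rewrite !le_max lexx !orbT.
  have m00 : 0 <= m by rewrite (le_trans _ ma).
  rewrite -(powRM _ n16 m00) powR_half_le ?mulr_ge0//.
  have := sqnormD_le (k - j) j; rewrite subrK => le2.
  apply: (@le_trans _ _ (16 * m)); first by have := s0 j; have := s0 (k - j); lra.
  by rewrite ler_wpM2r//; lra.
- move=> k j; rewrite /lattice_weight /lattice_dist /lattice_const -powR_half_max//.
  set m := Num.max (1 + _) _.
  have ma : 1 + sqnorm R k <= m by rewrite le_max lexx.
  have mb : 1 + sqnorm R j <= m by rewrite le_max lexx orbT.
  have m00 : 0 <= m by rewrite (le_trans _ ma).
  rewrite -(powRM _ n16 m00) powR_half_le ?mulr_ge0//.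
  have := sqnormD_le k (- j); rewrite sqnormN => le2.
  have k0 := s0 k; have j0 := s0 j.
  apply: (@le_trans _ _ (16 * m)); first by rewrite ge_max; apply/andP; split; lra.
  by rewrite ler_wpM2r//; lra.
- move=> s r us /powR_inv_half[q q0 ->].
  rewrite -size_filter; have [q1|q1] := leP 1 q.
    apply: ball_count => //; first exact: filter_uniq.
    move=> k; rewrite mem_filter powR_half_le ?(ltW q0)// => /andP[h1 _]; lra.
  (* For a radius below 1 the ball is empty. *)
  rewrite (eq_filter (a2 := pred0)) ?filter_pred0 ?mulr_ge0 ?powR_ge0//.
  by move=> k /=; rewrite powR_half_le ?(ltW q0)//; apply/negbTE; rewrite -ltNge; have := s0 k; lra.
- move=> j s r us /powR_inv_half[q q0 ->].
  rewrite -size_filter; have [q1|q1] := leP 1 q.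
    rewrite -(size_map (fun k => k - j)); apply: ball_count => //.
      by rewrite map_inj_uniq ?filter_uniq//; exact: addIr.
    move=> l /mapP[k]; rewrite mem_filter powR_half_le ?(ltW q0)//.
    rewrite ge_max => /andP[/andP[_ h1] _] ->.
    by [].
  rewrite (eq_filter (a2 := pred0)) ?filter_pred0 ?mulr_ge0 ?powR_ge0//.
  move=> k /=; rewrite powR_half_le ?(ltW q0)//; apply/negbTE; rewrite -ltNge.
  by rewrite lt_max q1.
- move=> j r r1; have /powR_inv_half[q q0 rE] : 0 < r by lra.
  have q1 : 1 <= q by rewrite -(powR_half_le ler01 (ltW q0)) powR1 -rE.
  have sq0 : 0 <= Num.sqrt q := sqrtr_ge0 _.
  have sq1 : 1 <= Num.sqrt q by rewrite -sqrtr1 ler_wsqrtr// ltW.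
  have := truncn_itv sq0; move: (Num.truncn _) => M /andP[M1 M2].
  have M2' : Num.sqrt q < M%:R + 1 by rewrite natr1.
  have qM : q < (M%:R + 1) ^+ 2.
    by rewrite -[ltLHS]sqr_sqrtr ?(ltW q0)// ltrXn2r ?nnegrE//; lra.
  have Mq : (M%:R + 1) ^+ 2 <= 4 * q.
    rewrite -[leRHS]sqr_sqrtr ?mulr_ge0 ?(ltW q0)// lerXn2r ?nnegrE ?addr_ge0 ?sqrtr_ge0//.
    rewrite sqrtrM// (_ : 4 = 2 ^+ 2) ?sqrtr_sqr ?ger0_norm//; last by ring.
    lra.
  (* A cube of side M + 1 displaced from [j], with M the integer part of the square root of [q]:
     every coordinate of the difference lies between M + 1 and 2 M + 1, so its squared norm exceeds
     [q] and is at most [16 * n * q]. *)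
  pose g (f : {ffun 'I_n -> 'I_M.+1}) : Zn n := j + \row_i (M.+1 + f i)%:Z.
  have ginj : injective g.
    move=> f1 f2 /addrI /rowP e; apply/ffunP => i; have := e i; rewrite !mxE => -[e'].
    by apply/val_inj/eqP; rewrite -(eqn_add2l M) e'.
  exists (map g (enum {ffun 'I_n -> 'I_M.+1})); split.
  + by rewrite map_inj_uniq ?enum_uniq.
  + rewrite size_map -cardE card_ffun !card_ord natrX rE powR_half ?ler0n// -powRM ?sqr_ge0//.
    rewrite powR_half_le ?(ltW q0) ?mulr_ge0 ?sqr_ge0// -(natr1 M).
    apply: le_trans (ltW qM) _; rewrite ler_peMl ?sqr_ge0//; lra.
  + move=> k /mapP[f _ ->]; rewrite /lattice_dist /g addrAC subrr add0r.
    have sqE : sqnorm R (\row_i (M.+1 + f i)%:Z) = \sum_i ((M%:R + 1 + (f i)%:R) ^+ 2).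
      by apply: eq_bigr => i _; rewrite mxE -pmulrn natrD -natr1.
    have lo : (M%:R + 1) ^+ 2 <= sqnorm R (\row_i (M.+1 + f i)%:Z).
      rewrite sqE (bigD1 (Ordinal n_gt0))//= -[leLHS]addr0 lerD//.
        by rewrite lerXn2r ?nnegrE ?addr_ge0// lerDl.
      by rewrite sumr_ge0// => i _; rewrite sqr_ge0.
    have up : sqnorm R (\row_i (M.+1 + f i)%:Z) <= n%:R * (4 * (M%:R + 1) ^+ 2).
      rewrite sqE; apply: (@le_trans _ _ (\sum_(i < n) (4 * (M%:R + 1) ^+ 2))); last first.
        by rewrite sumr_const card_ord -[leLHS]mulr_natl.
      apply: ler_sum => i _; rewrite (_ : 4 = 2 ^+ 2); last by ring.
      rewrite -exprMn lerXn2r ?nnegrE ?mulr_ge0 ?addr_ge0//.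
      have : (f i)%:R <= M%:R + 1 :> R by rewrite natr1 ler_nat ltnW.
      lra.
    rewrite max_r; last by lra.
    rewrite rE -powRM ?(ltW q0)// powR_half_le ?s0 ?mulr_ge0 ?(ltW q0)//; apply/andP; split.
      by rewrite gt0_ltr_powR ?nnegrE ?(ltW q0)// (lt_le_trans qM).
    apply: le_trans up _; have := ler_wpM2l (le_trans ler01 n1) Mq; lra.
- exists 0; rewrite /lattice_weight /sqnorm big1 ?addr0 ?powR1// => i _.
  by rewrite mxE expr0n.
Qed.

End IntegerLattice.

(** * Weighted sequence spaces and duality *)

Section FiniteSums.
Local Open Scope classical_set_scope.
Local Open Scope ring_scope.
Context {R : realType} {T : choiceType}.
Implicit Types (A : set T) (a : T -> R) (s : seq T).

Lemma esum_le_seq A a (B : R) : (forall s, uniq s -> (forall k, k \in s -> A k) ->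
    \sum_(k <- s) a k <= B) -> (\esum_(k in A) (a k)%:E <= B%:E)%E.
Proof.
move=> h; apply: ge_ereal_sup => _ [F [Ff FA] <-].
rewrite fsbig_finite// sumEFin lee_fin; apply: h; first exact: fset_uniq.
by move=> k; rewrite in_fset_set// => /set_mem /FA.
Qed.

Lemma seq_le_esum A a s : uniq s -> (forall k, k \in s -> A k) ->
  ((\sum_(k <- s) a k)%:E <= \esum_(k in A) (a k)%:E)%E.
Proof.
move=> us sA; apply: ereal_sup_ubound; exists [set` s].
  by split => // k; exact: sA.
by rewrite -fsbig_seq// sumEFin.
Qed.

Lemma esumZ_le A a (c : R) : 0 <= c -> (forall k, 0 <= a k) ->
  (\esum_(k in A) (c * a k)%:E <= c%:E * \esum_(k in A) (a k)%:E)%E.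
Proof.
move=> c0 a0; apply: ge_ereal_sup => _ [F [Ff FA] <-].
rewrite fsbig_finite// sumEFin -mulr_sumr EFinM lee_wpmul2l ?lee_fin//.
apply: seq_le_esum; first exact: fset_uniq.
by move=> k; rewrite in_fset_set// => /set_mem /FA.
Qed.

Lemma esumZ A a (c : R) : 0 <= c -> (forall k, 0 <= a k) ->
  (\esum_(k in A) (c * a k)%:E = c%:E * \esum_(k in A) (a k)%:E)%E.
Proof.
move=> + a0; rewrite le_eqVlt => /predU1P[<-|c0].
  by rewrite mul0e esum1// => k _; rewrite mul0r.
apply/le_anti/andP; split; first by apply: esumZ_le => //; exact: ltW.
have ca0 k : 0 <= c * a k by rewrite mulr_ge0// ltW.
have := @esumZ_le A (fun k => c * a k) c^-1 _ ca0; rewrite invr_ge0 ltW// => /(_ isT) h.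
have c0' : (0 <= c%:E)%E by rewrite lee_fin ltW.
have := lee_wpmul2l c0' h; rewrite muleA -EFinM divff ?gt_eqF// mul1e.
by apply: le_trans; rewrite le_eqVlt; apply/orP; left; apply/eqP; congr (_ * _)%E;
  apply: eq_esum => k _; rewrite mulKf ?gt_eqF.
Qed.

(** The sums of the positive and negative parts both lie between 0 and the sum of [h]. Finiteness
    matters because [fine] sends an infinite sum to 0. *)
Lemma rsum_norm_le A (g h : T -> R) : (forall k, A k -> `|g k| <= h k) ->
  (\esum_(k in A) (h k)%:E < +oo)%E ->
  `|fine (\esum_(x in A) (Num.max (g x) 0)%:E) - fine (\esum_(x in A) (Num.max (- g x) 0)%:E)|
  <= fine (\esum_(k in A) (h k)%:E).
Proof.
move=> gh hoo.
have key (g' : T -> R) : (forall k, A k -> g' k <= h k) ->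
    0 <= fine (\esum_(x in A) (Num.max (g' x) 0)%:E) <= fine (\esum_(k in A) (h k)%:E).
  move=> g'h.
  have pos : (0 <= \esum_(x in A) (Num.max (g' x) 0)%:E)%E.
    by apply: esum_ge0 => k _; rewrite lee_fin le_max lexx orbT.
  have le : (\esum_(x in A) (Num.max (g' x) 0)%:E <= \esum_(k in A) (h k)%:E)%E.
    apply: le_esum => k Ak; rewrite lee_fin ge_max g'h//=.
    exact: le_trans (normr_ge0 _) (gh _ Ak).
  rewrite fine_ge0//= fine_le//.
    by rewrite ge0_fin_numE// (le_lt_trans le).
  by rewrite ge0_fin_numE// (le_trans pos).
have /andP[p1 p2] : 0 <= fine (\esum_(x in A) (Num.max (g x) 0)%:E) <=
    fine (\esum_(k in A) (h k)%:E).
  by apply: key => k Ak; exact: le_trans (ler_norm _) (gh _ Ak).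
have /andP[n1 n2] : 0 <= fine (\esum_(x in A) (Num.max (- g x) 0)%:E) <=
    fine (\esum_(k in A) (h k)%:E).
  by apply: (key (fun k => - g k)) => k Ak; rewrite (le_trans (ler_norm _))// normrN gh.
rewrite ler_norml; apply/andP; split; lra.
Qed.

End FiniteSums.

Section LnormDuality.
Local Open Scope classical_set_scope.
Local Open Scope ring_scope.
Context {R : realType} {n : nat}.
Implicit Types (f g : Zn n -> R[i]) (p q : \bar R) (t s : R).

Lemma jbr_ge1 (k : Zn n) : 1 <= jbr R k.
Proof. by rewrite -[leLHS]sqrtr1 ler_wsqrtr// lerDl sqnorm_ge0. Qed.

Lemma cabs_ge0 (z : R[i]) : 0 <= cabs z. Proof. exact: sqrtr_ge0. Qed.

Lemma Re_le_cabs (z : R[i]) : `|complex.Re z| <= cabs z.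
Proof. by rewrite -sqrtr_sqr ler_wsqrtr// lerDl sqr_ge0. Qed.

Lemma Im_le_cabs (z : R[i]) : `|complex.Im z| <= cabs z.
Proof. by rewrite -sqrtr_sqr ler_wsqrtr// lerDr sqr_ge0. Qed.

Lemma cabs_le (z : R[i]) : cabs z <= `|complex.Re z| + `|complex.Im z|.
Proof.
rewrite /cabs -[leRHS]ger0_norm ?addr_ge0// -sqrtr_sqr ler_wsqrtr//.
by rewrite sqrrD !real_normK ?num_real// -addrA lerD2l lerDr mulrn_wge0.
Qed.

Let wabs t f (k : Zn n) := cabs (f k) * jbr R k `^ t.

Let wabs_ge0 t f k : 0 <= wabs t f k.
Proof. by rewrite mulr_ge0 ?cabs_ge0 ?powR_ge0. Qed.

(** Normal form linking the norms to [kernel_bounded]: the weighted modulus is dominated by N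
    u^(1/p) with [u] of mass at most 1, uniformly in finite and infinite [p]. *)
Lemma lnorm_witness p t f : (1 <= p)%E -> (lnorm p t f < +oo)%E ->
  exists N (u : Zn n -> R), [/\ 0 <= N, lnorm p t f = N%:E, forall k, 0 <= u k,
    forall l, uniq l -> \sum_(k <- l) u k <= 1 &
    forall k, wabs t f k <= N * u k `^ (invE p)].
Proof.
case: p => [r| |] //=; last first.
  move=> _; set A := ereal_sup _ => Aoo.
  have A0 k : ((wabs t f k)%:E <= A)%E by apply: ereal_sup_ubound; exists k.
  have Afin : A \is a fin_num.
    by rewrite ge0_fin_numE// (le_trans _ (A0 0))// lee_fin.
  (* For infinite [p] the zero family works, because 0^0 = 1. *)
  exists (fine A), (fun=> 0); split => //.
  - by rewrite fine_ge0// (le_trans _ (A0 0))// lee_fin.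
  - by rewrite fineK.
  - by move=> l _; rewrite big1.
  - by move=> k; rewrite powRr0 mulr1 -lee_fin fineK.
rewrite lee_fin => r1; have r0 : 0 < r by lra.
have rn0 : r^-1 != 0 by rewrite gt_eqF ?invr_gt0.
set S := esum _ _ => Soo.
have S0 : (0 <= S)%E by apply: esum_ge0 => k _; rewrite lee_fin powR_ge0.
have Sfin : S \is a fin_num by rewrite ge0_fin_numE//; exact: lty_poweRy rn0 Soo.
have SE : S = (fine S)%:E by rewrite fineK.
have sumS l : uniq l -> \sum_(k <- l) wabs t f k `^ r <= fine S.
  by move=> ul; rewrite -lee_fin fineK//; exact: seq_le_esum.
have fS0 : 0 <= fine S by rewrite fine_ge0.
exists (fine S `^ r^-1), (fun k => wabs t f k `^ r / fine S); split.
- exact: powR_ge0.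
- by rewrite SE poweR_EFin.
- by move=> k; rewrite divr_ge0 ?powR_ge0.
- move=> l ul; rewrite -mulr_suml; move: fS0; rewrite le_eqVlt => /predU1P[<-|S1].
    by rewrite invr0 mulr0.
  by rewrite ler_pdivrMr// mul1r sumS.
- move=> k; move: fS0; rewrite le_eqVlt => /predU1P[S1|S1].
    have := sumS [:: k] isT; rewrite big_seq1 -S1 => h.
    have /powR_eq0_eq0 -> : wabs t f k `^ r = 0 by apply/le_anti; rewrite h powR_ge0.
    by rewrite mulr_ge0 ?powR_ge0.
  rewrite powRM ?powR_ge0 ?invr_ge0 ?(ltW S1)// -powRrM mulfV ?gt_eqF// powRr1//.
  by rewrite powRV ?(ltW S1)// mulrCA mulfV ?mulr1// gt_eqF// powR_gt0.
Qed.

Lemma lnorm_le_witness p t f (N : R) (u : Zn n -> R) : (1 <= p)%E -> 0 <= N ->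
  (forall k, 0 <= u k) -> (forall l, uniq l -> \sum_(k <- l) u k <= 1) ->
  (forall k, wabs t f k <= N * u k `^ (invE p)) -> (lnorm p t f <= N%:E)%E.
Proof.
case: p => [r| |] //= + N0 u0 su hN; last first.
  move=> _; apply: ge_ereal_sup => _ [k _ <-]; rewrite lee_fin.
  by apply: le_trans (hN k) _; rewrite powRr0 mulr1.
rewrite lee_fin => r1; have r0 : 0 < r by lra.
have -> : N%:E = ((N `^ r)%:E `^ r^-1)%E.
  by rewrite poweR_EFin -powRrM mulfV ?gt_eqF// powRr1.
apply: gt0_ler_poweR; rewrite ?invr_ge0 ?(ltW r0)// ?in_itv/= ?leey ?andbT ?lee_fin ?powR_ge0//.
  by apply: esum_ge0 => k _; rewrite lee_fin powR_ge0.
apply: esum_le_seq => l ul _; apply: (@le_trans _ _ (\sum_(k <- l) N `^ r * u k)); last first.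
  by rewrite -mulr_sumr ler_piMr ?powR_ge0 ?su.
apply: ler_sum => k _.
have := ler_powRl (ltW r0) (wabs_ge0 t f k) (hN k).
by rewrite powRM ?powR_ge0// -powRrM mulVf ?gt_eqF// powRr1.
Qed.

(** Converse of Hölder's inequality, tested on finite lists only: a point mass when [q] is infinite,
    the normalised power of the function itself otherwise. *)
Lemma lnorm_le_dual q s f (M : R) : (1 <= q)%E -> 0 <= M ->
  (forall l (v : Zn n -> R), uniq l -> (forall k, 0 <= v k) -> \sum_(k <- l) v k <= 1 ->
    \sum_(k <- l) v k `^ (1 - invE q) * wabs s f k <= M) ->
  (lnorm q s f <= M%:E)%E.
Proof.
case: q => [r| |] //= + M0 hM; last first.
  move=> _; apply: ge_ereal_sup => _ [k _ <-]; rewrite lee_fin.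
  have := hM [:: k] (fun=> 1) isT (fun=> ler01).
  by rewrite !big_seq1 lexx powR1 mul1r => /(_ isT).
rewrite lee_fin => r1; have r0 : 0 < r by lra.
have -> : M%:E = ((M `^ r)%:E `^ r^-1)%E.
  by rewrite poweR_EFin -powRrM mulfV ?gt_eqF// powRr1.
apply: gt0_ler_poweR; rewrite ?invr_ge0 ?(ltW r0)// ?in_itv/= ?leey ?andbT ?lee_fin ?powR_ge0//.
  by apply: esum_ge0 => k _; rewrite lee_fin powR_ge0.
apply: esum_le_seq => l ul _.
set X := \sum_(k <- l) _; have X0 : 0 <= X by apply: sumr_ge0 => k _; exact: powR_ge0.
move: X0; rewrite le_eqVlt => /predU1P[<-|X0]; first exact: powR_ge0.
(* The extremal family in Hölder's inequality; its pairing with the function equals X^(1/r). *)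
have v0 k : 0 <= wabs s f k `^ r / X by rewrite divr_ge0 ?powR_ge0// ltW.
have := hM l _ ul v0; rewrite -mulr_suml -/X divff ?gt_eqF// lexx => /(_ isT) h.
have r1' : 0 <= 1 - r^-1 by rewrite subr_ge0 invf_le1.
have E1 : \sum_(k <- l) (wabs s f k `^ r / X) `^ (1 - r^-1) * wabs s f k = X `^ r^-1.
  rewrite (eq_bigr (fun k => wabs s f k `^ r * (X `^ (1 - r^-1))^-1)); last first.
    move=> k _; rewrite powRM ?powR_ge0 ?invr_ge0 ?(ltW X0)// powRV ?(ltW X0)//.
    rewrite mulrAC; congr (_ * _); have := wabs_ge0 s f k.
    rewrite le_eqVlt => /predU1P[<-|w0]; first by rewrite mulr0 powR0 ?gt_eqF.
    rewrite -powRrM -{2}[wabs s f k]powRr1 ?(ltW w0)// -powRD ?(gt_eqF w0) ?implybT//.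
    by congr (_ `^ _); field; rewrite gt_eqF.
  rewrite -mulr_suml -/X -powRN -{1}[X]powRr1 ?(ltW X0)// -powRD ?(gt_eqF X0) ?implybT//.
  by congr (_ `^ _); ring.
have XM : X `^ r^-1 <= M by rewrite -E1.
have := ler_powRl (ltW r0) (powR_ge0 _ _) XM.
by rewrite -powRrM mulVf ?gt_eqF// powRr1// ltW.
Qed.

End LnormDuality.

(** * Transfer to the fractional integral operator *)

Section Transfer.
Local Open Scope classical_set_scope.
Local Open Scope ring_scope.
Context {R : realType} {n : nat}.
Hypothesis n_gt0 : (0 < n)%N.
Variable lam : R.
Implicit Types (f : Zn n -> R[i]) (p q : \bar R) (s t : R) (k j : Zn n).

Let mu := lam / nR R n.

Definition frac_kernel s t k j : R := jbr R k `^ s * jbr R j `^ (- t) / kern lam k j.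

Let n0 : n%:R != 0 :> R. Proof. by rewrite pnatr_eq0 -lt0n. Qed.
Let jbr0 k : 0 < jbr R k. Proof. exact: lt_le_trans (jbr_ge1 k). Qed.

(** Off the diagonal |k - j| >= 1, so truncating the distance at 1 changes nothing, and all
    exponents are divided by [n]. *)
Lemma weighted_frac_kernel s t : off_diagonal (frac_kernel s t) =
  off_diagonal (weighted_kernel (@lattice_weight R n) (@lattice_dist R n) mu
    (- (s / nR R n)) (t / nR R n)).
Proof.
apply/funext => k; apply/funext => j; rewrite /off_diagonal; case: eqP => // /eqP kj.
have s0 l : 0 <= 1 + sqnorm R l by rewrite addr_ge0 ?sqnorm_ge0.
have s1 : 1 <= sqnorm R (k - j) by rewrite sqnorm_ge1// subr_eq0.
rewrite /frac_kernel /weighted_kernel /lattice_weight /lattice_dist max_r//.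
rewrite /jbr /kern -!powR12_sqrt ?sqnorm_ge0// -!powRrM -powRN.
by congr (_ `^ _ * _ `^ _ * _ `^ _); rewrite /mu /nR; field.
Qed.

Lemma fracI_bounded_of_kernel p q s t : (1 <= p)%E -> (1 <= q)%E ->
  kernel_bounded (off_diagonal (frac_kernel s t)) (invE p) (1 - invE q) ->
  fracI_bounded n lam p t q s.
Proof.
move=> p1 q1 /kernel_bounded_homogeneous[C C0 hC]; exists (2 * C) => f foo.
have [N [u [N0 fE u0 su hu]]] := lnorm_witness p1 foo.
pose g k j := if j == k then 0 else cabs (f j) / kern lam k j.
have g0 k j : 0 <= g k j.
  by rewrite /g; case: eqP => // _; rewrite divr_ge0 ?cabs_ge0 ?powR_ge0.
pose H k := (\esum_(j in [set: Zn n]) (g k j)%:E)%E.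
have fin_bound l1 l2 v : uniq l1 -> uniq l2 -> (forall k, 0 <= v k) ->
    \sum_(k <- l2) v k <= 1 ->
    \sum_(j <- l1) \sum_(k <- l2) v k `^ (1 - invE q) * jbr R k `^ s * g k j <= N * C.
  move=> ul1 ul2 v0 sv.
  have := hC l1 l2 u v 1 1 ul1 ul2 u0 v0 ltr01 ltr01 (su _ ul1) sv.
  rewrite !powR1 !mulr1 => /(ler_wpM2l N0); apply: le_trans.
  rewrite mulr_sumr; apply: ler_sum => j _; rewrite mulr_sumr; apply: ler_sum => k _.
  rewrite /g /off_diagonal eq_sym; case: eqP => [_|/eqP kj]; first by rewrite !mulr0.
  have fj : cabs (f j) <= N * u j `^ invE p * jbr R j `^ (- t).
    by rewrite powRN ler_pdivlMr ?powR_gt0.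
  have kk : 0 <= v k `^ (1 - invE q) * jbr R k `^ s / kern lam k j.
    by rewrite !mulr_ge0 ?invr_ge0 ?powR_ge0.
  have := ler_wpM2l kk fj; rewrite /frac_kernel.
  move: (v k `^ _) (u j `^ _) (jbr R k `^ s) (jbr R j `^ _) (kern lam k j)^-1 (cabs (f j)).
  by move=> a1 a2 a3 a4 a5 a6; congr (_ <= _); ring.
(* Testing with a unit mass at [k] shows that the series at [k] converges absolutely. *)
have H_fin k : (H k <= (N * C / jbr R k `^ s)%:E)%E.
  apply: esum_le_seq => l ul _; rewrite ler_pdivlMr ?powR_gt0//.
  have := fin_bound l [:: k] (fun=> 1) ul isT (fun=> ler01).
  rewrite big_seq1 lexx => /(_ isT); apply: le_trans; rewrite mulr_suml; apply: ler_sum => j _.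
  by rewrite big_seq1 powR1 mul1r mulrC.
have H0 k : (0 <= H k)%E by apply: esum_ge0 => j _; rewrite lee_fin.
have H_num k : H k \is a fin_num.
  by rewrite ge0_fin_numE// (le_lt_trans (H_fin k))// ltry.
have HE k : H k = (\esum_(j in [set j | j != k]) (cabs (f j) / kern lam k j)%:E)%E.
  rewrite [RHS]esum_mkcond; apply: eq_esum => j _; rewrite /g.
  by case: eqP => [->|/eqP jk]; [rewrite memNset//= => /negP|rewrite mem_set].
split=> [k|].
  rewrite /fracI_defined /summable (le_lt_trans _ (le_lt_trans (H_fin k) (ltry _)))//.
  rewrite HE; apply: le_esum => j _.
  by rewrite /= ger0_norm// divr_ge0 ?cabs_ge0 ?powR_ge0.
rewrite fE -EFinM; apply: lnorm_le_dual => //; first by rewrite !mulr_ge0.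
move=> l v ul v0 sv.
(* The real and imaginary parts are estimated separately, hence the factor 2. *)
have cI k : cabs (fracI lam f k) <= 2 * fine (H k).
  have hoo : (\esum_(j in [set j | j != k]) (cabs (f j) / kern lam k j)%:E < +oo)%E.
    by rewrite -HE (le_lt_trans (H_fin k))// ltry.
  apply: le_trans (cabs_le _) _; rewrite mulr_natl mulr2n HE.
  apply: lerD; apply: rsum_norm_le => // j jk /=; rewrite normrM normfV (ger0_norm (powR_ge0 _ _));
    rewrite ler_wpM2r ?invr_ge0 ?powR_ge0//; [exact: Re_le_cabs|exact: Im_le_cabs].
apply: (@le_trans _ _ (2 * \sum_(k <- l) v k `^ (1 - invE q) * jbr R k `^ s * fine (H k))).
  rewrite mulr_sumr; apply: ler_sum => k _.
  have c0 : 0 <= v k `^ (1 - invE q) * jbr R k `^ s by rewrite mulr_ge0 ?powR_ge0.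
  by have := ler_wpM2l c0 (cI k); congr (_ <= _); ring.
rewrite -mulrA ler_wpM2l// [C * N]mulrC -lee_fin -sumEFin.
rewrite (eq_bigr (fun k => \esum_(j in [set: Zn n])
    (v k `^ (1 - invE q) * jbr R k `^ s * g k j)%:E)%E); last first.
  by move=> k _; rewrite esumZ ?mulr_ge0 ?powR_ge0// EFinM fineK.
rewrite -esum_sum; last by move=> j k _ _; rewrite lee_fin !mulr_ge0 ?powR_ge0.
apply: le_trans (esum_le_seq (a := fun j =>
    \sum_(k <- l) v k `^ (1 - invE q) * jbr R k `^ s * g k j)
  (fun l1 ul1 _ => fin_bound l1 l v ul1 ul v0 sv)).
by apply: le_esum => j _; rewrite sumEFin.
Qed.

Lemma sum_mem_le (T : eqType) (l l' : seq T) (u : T -> R) : uniq l -> uniq l' ->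
  (forall i, 0 <= u i) -> \sum_(i <- l | i \in l') u i <= \sum_(i <- l') u i.
Proof.
move=> ul ul' u0; rewrite -big_filter (perm_big [seq i <- l' | i \in l]).
  by rewrite big_filter big_mkcond; apply: ler_sum => i _; case: ifP.
by apply: uniq_perm; rewrite ?filter_uniq// => i; rewrite !mem_filter andbC.
Qed.

Lemma invE_itv p : (1 <= p)%E -> 0 <= invE p <= 1.
Proof.
case: p => [r| |] //= p1; last by rewrite lexx ler01.
have r0 : 0 < r by apply: lt_le_trans ltr01 _; rewrite -lee_fin.
by rewrite invr_ge0 (ltW r0) invf_le1// -lee_fin.
Qed.

(** The operator is applied to the nonnegative, finitely supported function built from [u]. Its
    image is dominated by N w^(1/q), and v^(1-1/q) w^(1/q) <= v + w replaces Hölder's inequality, at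
    the price of a factor 2. *)
Lemma kernel_of_fracI_bounded p q s t : (1 <= p)%E -> (1 <= q)%E ->
  fracI_bounded n lam p t q s ->
  kernel_bounded (off_diagonal (frac_kernel s t)) (invE p) (1 - invE q).
Proof.
move=> p1 q1 [C hC]; exists (2 * `|C|) => l1 l2 u v ul1 ul2 u0 v0 su sv.
pose phi j := if j \in l1 then u j `^ invE p * jbr R j `^ (- t) else 0.
have phi0 j : 0 <= phi j by rewrite /phi; case: ifP => // _; rewrite mulr_ge0 ?powR_ge0.
pose f : Zn n -> R[i] := fun j => Complex (phi j) 0.
have cf j : cabs (f j) = phi j by rewrite /cabs /= expr0n addr0 sqrtr_sqr ger0_norm.
have f1 : (lnorm p t f <= 1%:E)%E.
  apply: (@lnorm_le_witness _ _ p t f 1 (fun j => if j \in l1 then u j else 0)) => //.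
  - by move=> j; case: ifP.
  - move=> l ul; apply: le_trans su.
    by rewrite -big_mkcond; exact: sum_mem_le.
  - move=> j; rewrite mul1r cf /phi; case: ifP => _; last by rewrite mul0r powR_ge0.
    by rewrite powRN divfK// gt_eqF ?powR_gt0.
have [fdef fle] := hC f (le_lt_trans f1 (ltry _)).
have fC : (lnorm q s (fracI lam f) <= `|C|%:E)%E.
  (* Only the real value of the norm is extracted here; [C] may be negative, hence the passage to
     its absolute value. *)
  have [N [_ [N0 NE _ _ _]]] := lnorm_witness p1 (le_lt_trans f1 (ltry _)).
  apply: le_trans fle _; rewrite NE -EFinM lee_fin.
  have N1 : N <= 1 by rewrite -lee_fin -NE.
  apply: le_trans (ler_norm _) _; rewrite normrM (ger0_norm N0) ler_piMr//.
have [N [w [N0 NE w0 sw hw]]] := lnorm_witness q1 (le_lt_trans fC (ltry _)).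
have NC : N <= `|C| by rewrite -lee_fin -NE.
have fineP k : \sum_(j <- l1 | j != k) phi j / kern lam k j <= cabs (fracI lam f k).
  have := le_trans (ler_norm _) (Re_le_cabs (fracI lam f k)).
  apply: le_trans; rewrite /= /rsum.
  have gp j : 0 <= phi j / kern lam k j by rewrite divr_ge0// powR_ge0.
  (* The terms are nonnegative, so the negative part vanishes; the positive part is finite by
     [fdef], so [fine] loses nothing. *)
  rewrite [X in _ - fine X]esum1 ?subr0; last by move=> j _; rewrite max_r// oppr_le0.
  rewrite (eq_esum (b := fun j => (phi j / kern lam k j)%:E)); last by move=> j _; rewrite max_l.
  have Hfin : (\esum_(j in [set j | j != k]) (phi j / kern lam k j)%:E \is a fin_num)%E.
    rewrite ge0_fin_numE; last by apply: esum_ge0 => j _; rewrite lee_fin.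
    apply: le_lt_trans (fdef k); apply: le_esum => j _.
    by rewrite cf lee_fin ler_norm.
  rewrite -lee_fin fineK// -big_filter; apply: seq_le_esum; first exact: filter_uniq.
  by move=> j; rewrite mem_filter => /andP[].
have q01 := invE_itv q1.
rewrite exchange_big /=; apply: (@le_trans _ _ (\sum_(k <- l2) N * (v k + w k))); last first.
  rewrite -mulr_sumr big_split /= mulrC; apply: ler_pM => //.
    by rewrite addr_ge0// sumr_ge0.
  by rewrite -[2]/(1 + 1) lerD// sw.
apply: ler_sum => k _.
apply: (@le_trans _ _ (v k `^ (1 - invE q) * (cabs (fracI lam f k) * jbr R k `^ s))).
  have c0 : 0 <= v k `^ (1 - invE q) * jbr R k `^ s by rewrite mulr_ge0 ?powR_ge0.
  rewrite mulrCA; apply: le_trans (ler_wpM2r c0 (fineP k)).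
  rewrite mulr_suml [leRHS]big_mkcond [leLHS]big_seq [leRHS]big_seq; apply: ler_sum => j jl.
  rewrite /off_diagonal eq_sym; case: eqP => [_|_] /=; first by rewrite mulr0.
  rewrite /phi jl /frac_kernel.
  move: (v k `^ _) (u j `^ _) (jbr R k `^ s) (jbr R j `^ _) (kern lam k j)^-1 => a1 a2 a3 a4 a5.
  by rewrite le_eqVlt; apply/orP; left; apply/eqP; ring.
apply: le_trans (ler_wpM2l (powR_ge0 _ _) (hw k)) _; rewrite mulrCA ler_wpM2l//.
have y01 : 0 <= 1 - invE q <= 1 by apply/andP; split; lra.
have := weighted_product_le_sum (v0 k) (w0 k) y01.
by rewrite subKr.
Qed.

End Transfer.

(** * Translation of the exponent conditions, and the theorem *)

Lemma invE_eq0 (R : realType) (p : \bar R) : (1 <= p)%E -> (invE p == 0) = (p == +oo%E).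
Proof.
case: p => [r| |] //=; rewrite ?eqxx// lee_fin => r1.
by rewrite invr_eq0 gt_eqF// (lt_le_trans ltr01).
Qed.

Lemma invE_eq1 (R : realType) (p : \bar R) : (invE p == 1) = (p == 1%E).
Proof. by case: p => [r| |] /=; rewrite ?invr_eq1// eq_sym oner_eq0. Qed.

Lemma dualE_eq1 (R : realType) (q : \bar R) : (dualE q = 1%E) <-> (q = +oo%E).
Proof.
split=> [|->//]; case: q => [r| |] //=; case: eqP => // r1 [].
have r10 : r - 1 != 0 by rewrite subr_eq0; exact/eqP.
move=> /(congr1 ( *%R ^~ (r - 1))); rewrite divfK// mul1r => /eqP.
by rewrite -subr_eq0 opprB addrCA subrr addr0 oner_eq0.
Qed.

(** The left side is at least [mu > 0], so the maximum on the right must be attained by [b]. *)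
Lemma max0_lt_max0 (R : realType) (mu a b : R) : 0 < mu ->
  (mu + Num.max a 0 < Num.max b 0) = (mu < b) && (mu + a < b).
Proof.
move=> mu0; rewrite addr_maxr addr0 gt_max !lt_max.
by have [h|h] := boolP (mu < b); apply/idP/idP => /=; lra.
Qed.

(** Put al = 1/q + s/n and be = 1/p + t/n. The endpoint x = 1, tt = mu - 1 means be = mu, where
    subcriticality reads al < 0: this is [condC3]. The endpoint in [y] is the equality case mu + al
    = 1 of [condC1]. *)
Lemma admissibleP (R : realType) (n : nat) (lam : R) (p q : \bar R) (s t : R) :
  (1 <= n)%N -> 0 < lam -> lam < n%:R -> (1 <= p)%E -> (1 <= q)%E ->
  admissible (lam / nR R n) (invE p) (1 - invE q) (- (s / nR R n)) (t / nR R n) <->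
  condC1 n lam q p s t \/ condC3 n lam q p s t \/ condC4 n lam q p s t.
Proof.
move=> n1 lam0 lamn p1 q1.
have n0 : 0 < nR R n by rewrite ltr0n.
have := invE_itv p1; have := invE_itv q1.
have := invE_eq0 q1; have := invE_eq1 p.
have st : (0 <= - (s / nR R n) + t / nR R n) = (s <= t).
  by rewrite addrC subr_ge0 ler_pM2r ?invr_gt0.
have st0 : (- (s / nR R n) + t / nR R n = 0) <-> (s = t).
  split=> [/eqP|->]; last by rewrite addNr.
  by rewrite addrC subr_eq0 => /eqP/(mulIf _) ->//; rewrite invr_eq0 gt_eqF.
have sE : (- (s / nR R n) = lam / nR R n - 1) <-> (- s = lam - nR R n).
  split=> [/(congr1 ( *%R ^~ (nR R n)))|e]; first by rewrite mulNr mulrBl !divfK ?gt_eqF// mul1r.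
  by rewrite -mulNr e mulrBl divff ?gt_eqF.
have tE : (t / nR R n = lam / nR R n - 1) <-> (t = lam - nR R n).
  split=> [/(congr1 ( *%R ^~ (nR R n)))|e]; first by rewrite mulrBl !divfK ?gt_eqF// mul1r.
  by rewrite e mulrBl divff ?gt_eqF.
have mu0 : 0 < lam / nR R n by rewrite divr_gt0.
have mu1 : lam / nR R n < 1 by rewrite ltr_pdivrMr// mul1r.
rewrite /admissible /condC1 /condC3 /condC4 st.
have := dualE_eq1 q; move: {st p1 q1 n0 n1 lam0 lamn} mu0 mu1 st0 sE tE.
move: (lam / nR R n) (s / nR R n) (t / nR R n) (invE p) (invE q) => mu sg tt x y.
move=> mu0 mu1 st0 sE tE dq p1E q0E /andP[y0 y1] /andP[x0 x1].
have p1E' : x = 1 <-> p = 1%E by split => /eqP; [rewrite p1E|rewrite -p1E] => /eqP.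
have q0E' : y = 0 <-> q = +oo%E by split => /eqP; [rewrite q0E|rewrite -q0E] => /eqP.
rewrite -(addrA mu y sg) max0_lt_max0//; set al := y + sg; set be := x + tt.
have -> : 1 - y - sg = 1 - al by rewrite -addrA -opprD.
have -> : (be + (1 - al) = 1 + mu) = (mu + al = be).
  by apply/propext; split => h; move: al be h => a b h; lra.
have -> : (1 + mu < be + (1 - al)) = (mu + al < be).
  by rewrite addrCA ltrD2l ltrBrDr.
have -> : (mu < 1 - al) = (mu + al < 1) by rewrite ltrBrDr.
have -> : (1 - al < 1) = (0 < al) by rewrite gtrBl.
have -> : (1 <= x + (1 - y)) = (y <= x) by rewrite addrCA lerDl subr_ge0.
have -> : (1 - y = 1) = (y = 0).
  by apply/propext; split => [h|->]; [lra|rewrite subr0].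
have -> : (1 - y < 1) = (0 < y) by rewrite gtrBl.
split.
- move=> [le_st [[AB hA hB]|[AB xy hB hA hst]]]; last first.
    right; right; do 5?[split=> //] => /st0/hst[h1 h2].
    by split=> [/q0E' yE|/p1E' xE]; [move: h2; rewrite yE ltxx|move: h1; rewrite xE ltxx].
  case: hB => [hB|[xE ttE]]; last first.
    right; left; split => //; [exact/p1E'|exact/tE|].
    by move: AB; rewrite /be xE ttE subrKC gtrDl.
  left; split => //; first by rewrite hB.
    by case: hA => [/ltW//|[yE sgE]]; rewrite /al yE add0r -[sg]opprK sgE opprB subrKC.
  case: hA => [h e|[yE sgE] _]; first by move: h; rewrite e ltxx.
  by split; [exact/dq/q0E'|exact/sE].
- move=> [[le_st /andP[hB AB] hA hE]|[[le_st /p1E' xE /tE ttE al0]|[le_st [AB [xy [hA [hB hst]]]]]]].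
  + split=> //; left; split=> //; last by left.
    move: hA; rewrite le_eqVlt => /predU1P[e|e]; last by left.
    have [/dq/q0E' yE /sE sgE] := hE e; by right.
  + have beE : be = mu by rewrite /be xE ttE subrKC.
    split=> //; left; split; [by rewrite beE gtrDl| |by right].
    by left; apply: lt_trans mu1; rewrite gtrDl.
  + split=> //; right; split=> // /st0/hst[h1 h2]; split.
      by rewrite lt_neqAle x1 andbT; apply/eqP => /p1E'.
    by rewrite lt_neqAle y0 andbT; apply/eqP => /esym/q0E'.
Qed.

Theorem theorem1p6 (R : realType) (n : nat) (lam : R) (p q : \bar R) (s t : R) :
  (1 <= n)%N -> 0 < lam -> lam < n%:R -> (1 <= p)%E -> (1 <= q)%E ->
  fracI_bounded n lam p t q s <->
  condC1 n lam q p s t \/ condC3 n lam q p s t \/ condC4 n lam q p s t.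
Proof.
move=> n1 lam0 lamn p1 q1; rewrite -admissibleP//.
have mu01 : 0 < lam / nR R n < 1.
  by rewrite divr_gt0 ?ltr0n//= ltr_pdivrMr ?ltr0n// mul1r.
have x01 := invE_itv p1.
have y01 : 0 <= 1 - invE q <= 1 by have := invE_itv q1; lra.
have reg := @lattice_regular R n n1.
split=> [/(kernel_of_fracI_bounded p1 q1)|adm].
  by rewrite weighted_frac_kernel// => /(admissible_necessary reg mu01 x01 y01).
apply: fracI_bounded_of_kernel => //; rewrite weighted_frac_kernel//.
(* Sufficiency was proved with the diagonal included, which only enlarges the nonnegative kernel. *)
apply: kernel_bounded_le ler01 _ (kernel_bounded_admissible reg mu01 x01 y01 adm) => k j.
by rewrite mul1r /off_diagonal; case: eqP => // _; exact: weighted_kernel_ge0.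
Qed.
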